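(* Let $\mathcal{C}$ be any one of the following classes of relational inquisitive epistemic models (for a set $\mathcal{A}$ of agents): all such models; all finite such models; all locally full such models; all finite locally full such models. Then: (a) a property of world-pointed models $(\mathfrak{M},w)$ with $\mathfrak{M}\in\mathcal{C}$ is definable in (multi-agent) InqML over $\mathcal{C}$ if and only if it is both first-order definable over $\mathcal{C}$ and invariant under $\sim$ over $\mathcal{C}$; (b) a property of state-pointed models $(\mathfrak{M},s)$ with $\mathfrak{M}\in\mathcal{C}$ is definable in InqML over $\mathcal{C}$ if and only if it is first-order definable over $\mathcal{C}$, downward closed, and invariant under $\sim$ over $\mathcal{C}$.
   Context: Let $\mathcal{P}=\{p_i:i\in I\}$ be a set of atoms and $\mathcal{A}$ a set of agents. A relational (multi-modal) inquisitive model is a two-sorted structure $\mathfrak{M}=(W,S,(E_a)_{a\in\mathcal{A}},\varepsilon,(P_i)_{i\in I})$ with non-empty $W$ (worlds), $S$ (states), $E_a,\varepsilon\subseteq W\times S$, $P_i\subseteq W$, such that with $\underline s=\{w:w\,\varepsilon\,s\}$: $\underline s=\underline{s'}$ implies $s=s'$; if $s\in S$ and $t\subseteq\underline s$ then $t=\underline{s'}$ for some $s'\in S$; $E_a[w]\ne\emptyset$ for all $w,a$; if $s\in E_a[w]$ and $\underline{s'}\subseteq\underline s$ then $s'\in E_a[w]$. Identify $S$ with a family of subsets of $W$. It is epistemic (S5) if for each $a$, $R_a:=\{(w,w'):w'\in\bigcup E_a[w]\}$ is an equivalence relation and $E_a[w]=E_a[w']$ whenever $(w,w')\in R_a$. It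 is finite if $W,S$ are finite, and locally full if $\wp(\bigcup E_a[w])\subseteq S$ for all $w\in W$, $a\in\mathcal{A}$. World-pointed: $(\mathfrak{M},w)$, $w\in W$; state-pointed: $(\mathfrak{M},s)$, $s\in S$. $\mathfrak{M}$ determines the inquisitive model $\mathfrak{M}^*=(W,(\Sigma_a)_a,V)$ with $\Sigma_a(w)=E_a[w]$, $V(p_i)=P_i$, and $\sigma_a(w):=\bigcup\Sigma_a(w)$. InqML formulae: $\varphi::=p\mid\bot\mid\varphi\wedge\varphi\mid\varphi\to\varphi\mid\varphi\bar\vee\varphi\mid\Box_a\varphi\mid\boxplus_a\varphi$ ($a\in\mathcal{A}$), with support on states $s\subseteq W$: $s\models p$ iff $s\subseteq V(p)$; $s\models\bot$ iff $s=\emptyset$; $\wedge$ componentwise; $s\models\varphi\to\psi$ iff every $t\subseteq s$ supporting $\varphi$ supports $\psi$; $s\models\varphi\bar\vee\psi$ iff $s$ supports one of them; $s\models\Box_a\varphi$ iff $\sigma_a(w)\models\varphi$ for all $w\in s$; $s\models\boxplus_a\varphi$ iff every $t\in\Sigma_a(w)$, $w\in s$, supports $\varphi$. Truth at $w$ is support at $\{w\}$. InqML-definability over $\mathcal{C}$ of a world (state) property: some formula is true at $w$ (supported at $s$) in $\mathfrak{M}^*$ exactly when the property holds, for all pointed models with $\mathfrak{M}\in\mathcal{C}$. First-order logic is two-sorted with binary symbols $E_a$ ($a\in\mathcal{A}$) and $\varepsilon$, unary $P_i$, equality; first-order definability over $\mathcal{C}$ means definability by a formula $\varphi(x)$ with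 one free variable of the appropriate sort on all pointed models from $\mathcal{C}$. Bisimulation game: from a world-position $(w,w')$ player I chooses an agent $a$ and a state in $\Sigma_a(w)$ or $\Sigma'_a(w')$, II answers with a state in $\Sigma'_a(w')$ resp. $\Sigma_a(w)$; from a state-position $(s,s')$, I picks a world in $s$ or $s'$, II answers with a world in the other. A stuck player loses; II loses at world-positions disagreeing on an atom; all other plays (including infinite ones) are won by II. $(\mathfrak{M},w)\sim(\mathfrak{M}',w')$ iff II wins the unbounded game from $(w,w')$ on $\mathfrak{M}^*,\mathfrak{M}'^*$; $(\mathfrak{M},s)\sim(\mathfrak{M}',s')$ iff every world of $s$ is bisimilar to some world of $s'$ and vice versa. Invariance under $\sim$ over $\mathcal{C}$: the property agrees on bisimilar pointed models from $\mathcal{C}$. A state property is downward closed if it holds of $(\mathfrak{M},t)$ whenever it holds of $(\mathfrak{M},s)$ and $t\subseteq s$, $t\in S$.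
   Formalization: In (b) the right-hand side also requires that the property hold of at least one state-pointed model over the class; the property holding nowhere is first-order definable, downward closed and invariant, but not InqML-definable, since the empty state supports every formula. *)

(* Defs.v *)
From Stdlib Require Import RelationClasses.
From mathcomp Require Import all_boot.
From mathcomp Require Import boolp classical_sets cardinality.

Set Implicit Arguments.
Unset Strict Implicit.
Unset Printing Implicit Defensive.

Local Open Scope classical_set_scope.

(* [Ag] is the type of agents, [At] the type indexing the atoms. *)

Record inqmodel (Ag At : Type) := InqModel {
  iworld : Type;
  iworld_inh : inhabited iworld;
  iSigma : Ag -> iworld -> set (set iworld);
  iV : At -> set iworld;
  iSigma_neq0 : forall a w, iSigma a w !=set0;
  iSigma_down : forall a w s t, iSigma a w s -> t `<=` s -> iSigma a w t
}.

Definition isigma Ag At (M : inqmodel Ag At) (a : Ag) (w : iworld M) :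
    set (iworld M) :=
  \bigcup_(s in iSigma a w) s.

(* [underl eps s] is the set of worlds of which the abstract state [s] is the
   code. *)
Definition underl (W S : Type) (eps : W -> S -> Prop) (s : S) : set W :=
  [set w | eps w s].

Record relmodel (Ag At : Type) := RelModel {
  world : Type;
  state : Type;
  rE : Ag -> world -> state -> Prop;
  eps : world -> state -> Prop;
  rP : At -> set world;
  world_inh : inhabited world;
  state_inh : inhabited state;
  state_ext : forall s s', underl eps s = underl eps s' -> s = s';
  state_down : forall s (t : set world), t `<=` underl eps s ->
    exists s', t = underl eps s';
  rE_neq0 : forall a w, exists s, rE a w s;
  rE_down : forall a w s s', rE a w s -> underl eps s' `<=` underl eps s ->
    rE a w s'
}.

Definition worlds_of Ag At (M : relmodel Ag At) (s : state M) :
    set (world M) :=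
  underl (@eps _ _ M) s.

Section Star.
Variables (Ag At : Type) (M : relmodel Ag At).

Definition star_Sigma (a : Ag) (w : world M) : set (set (world M)) :=
  [set worlds_of s | s in [set s | rE a w s]].

Lemma star_Sigma_neq0 a w : star_Sigma a w !=set0.
Proof. by have [s Es] := rE_neq0 a w; exists (worlds_of s), s. Qed.

Lemma star_Sigma_down a w s t :
  star_Sigma a w s -> t `<=` s -> star_Sigma a w t.
Proof.
move=> [u /= Eu <-] tu; have [v tE] := state_down tu.
by exists v; [apply: (rE_down Eu); rewrite -tE | rewrite tE].
Qed.

Definition star : inqmodel Ag At :=
  InqModel (world_inh M) (@rP _ _ M) star_Sigma_neq0 star_Sigma_down.

End Star.

Section Classes.
Variables (Ag At : Type) (M : relmodel Ag At).

Definition accessible (a : Ag) (w w' : world M) : Prop :=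
  (\bigcup_(s in [set s | rE a w s]) worlds_of s) w'.

Definition epistemic : Prop :=
  forall a, Equivalence (accessible a) /\
    forall w w', accessible a w w' -> forall s, rE a w s <-> rE a w' s.

Definition finite_model : Prop :=
  finite_set [set: world M] /\ finite_set [set: state M].

Definition locally_full : Prop :=
  forall a (w : world M) (t : set (world M)), t `<=` accessible a w ->
    exists s : state M, worlds_of s = t.

End Classes.

Inductive model_class :=
  | AllModels | FiniteModels | LocallyFullModels | FiniteLocallyFullModels.

Definition in_class Ag At (C : model_class) (M : relmodel Ag At) : Prop :=
  match C with
  | AllModels => epistemic M
  | FiniteModels => epistemic M /\ finite_model M
  | LocallyFullModels => epistemic M /\ locally_full M
  | FiniteLocallyFullModels =>
      [/\ epistemic M, finite_model M & locally_full M]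
  end.

Inductive inqml (Ag At : Type) :=
  | IAtom (i : At)
  | IBot
  | IAnd (f g : inqml Ag At)
  | IImp (f g : inqml Ag At)
  | IOr (f g : inqml Ag At)
  | IBox (a : Ag) (f : inqml Ag At)
  | IWindow (a : Ag) (f : inqml Ag At).

Fixpoint support Ag At (M : inqmodel Ag At) (s : set (iworld M))
    (f : inqml Ag At) : Prop :=
  match f with
  | IAtom i => s `<=` iV i
  | IBot => s = set0
  | IAnd f g => support s f /\ support s g
  | IImp f g => forall t, t `<=` s -> support t f -> support t g
  | IOr f g => support s f \/ support s g
  | IBox a f => forall w, s w -> support (isigma a w) f
  | IWindow a f => forall w, s w -> forall t, iSigma a w t -> support t f
  end.

Definition true_at Ag At (M : inqmodel Ag At) (w : iworld M)
    (f : inqml Ag At) : Prop :=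
  support [set w] f.

(* Two-sorted first-order formulae whose free variables are among [m] world
   variables and [n] state variables (de Bruijn indices, separately for each
   sort).  The other connectives and the existential quantifiers are definable,
   the metatheory being classical. *)
Inductive fo (Ag At : Type) (m n : nat) :=
  | FE (a : Ag) (x : 'I_m) (y : 'I_n)
  | Feps (x : 'I_m) (y : 'I_n)
  | FP (i : At) (x : 'I_m)
  | FEqW (x x' : 'I_m)
  | FEqS (y y' : 'I_n)
  | FBot
  | FImp (f g : fo Ag At m n)
  | FAllW (f : fo Ag At m.+1 n)
  | FAllS (f : fo Ag At m n.+1).

Fixpoint sat Ag At (M : relmodel Ag At) m n (f : fo Ag At m n)
    (u : m.-tuple (world M)) (v : n.-tuple (state M)) : Prop :=
  match f with
  | FE a x y => rE a (tnth u x) (tnth v y)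
  | Feps x y => eps (tnth u x) (tnth v y)
  | FP i x => rP i (tnth u x)
  | FEqW x x' => tnth u x = tnth u x'
  | FEqS y y' => tnth v y = tnth v y'
  | FBot => False
  | FImp f g => sat f u v -> sat g u v
  | FAllW f => forall w, sat f [tuple of w :: u] v
  | FAllS f => forall s, sat f u [tuple of s :: v]
  end.

Section Game.
Variables (Ag At : Type) (M M' : inqmodel Ag At).

(* Player I moves at [WPos] and [SPos]; at the other positions, which record
   the choice just made by I in M ([..L]) or in M' ([..R]) and the element II
   has to match, player II moves. *)
Inductive position :=
  | WPos (w : iworld M) (w' : iworld M')
  | WAnsL (a : Ag) (s : set (iworld M)) (w' : iworld M')
  | WAnsR (a : Ag) (w : iworld M) (s' : set (iworld M'))
  | SPos (s : set (iworld M)) (s' : set (iworld M'))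
  | SAnsL (w : iworld M) (s' : set (iworld M'))
  | SAnsR (s : set (iworld M)) (w' : iworld M').

Inductive moveI : position -> position -> Prop :=
  | MoveWL a w w' s : iSigma a w s -> moveI (WPos w w') (WAnsL a s w')
  | MoveWR a w w' s' : iSigma a w' s' -> moveI (WPos w w') (WAnsR a w s')
  | MoveSL s s' w : s w -> moveI (SPos s s') (SAnsL w s')
  | MoveSR s s' w' : s' w' -> moveI (SPos s s') (SAnsR s w').

Inductive moveII : position -> position -> Prop :=
  | AnswerWL a s w' s' : iSigma a w' s' -> moveII (WAnsL a s w') (SPos s s')
  | AnswerWR a w s' s : iSigma a w s -> moveII (WAnsR a w s') (SPos s s')
  | AnswerSL w s' w' : s' w' -> moveII (SAnsL w s') (WPos w w')
  | AnswerSR s w' w : s w -> moveII (SAnsR s w') (WPos w w').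

Definition II_to_move (p : position) : bool :=
  match p with WPos _ _ | SPos _ _ => false | _ => true end.

Definition atom_clash (p : position) : Prop :=
  match p with
  | WPos w w' => ~ forall i, iV i w <-> iV i w'
  | _ => False
  end.

(* A strategy for II maps a history, the list of the positions visited so far
   with the current one first, to the next position. *)
Definition strategy := seq position -> position.

(* [consistent F p0 p h]: the history with current position [p] and past [h]
   arises in a play from [p0] in which II follows [F]. *)
Inductive consistent (F : strategy) (p0 : position) :
    position -> seq position -> Prop :=
  | ConsistentStart : consistent F p0 p0 [::]
  | ConsistentI p q h : consistent F p0 p h -> moveI p q ->
      consistent F p0 q (p :: h)
  | ConsistentII p h : consistent F p0 p h -> moveII p (F (p :: h)) ->
      consistent F p0 (F (p :: h)) (p :: h).

(* II loses a play only by reaching an atom clash or by failing to make a legal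
   move, so F is winning when neither ever happens; infinite plays and plays in
   which I gets stuck are then won by II. *)
Definition winning (F : strategy) (p0 : position) : Prop :=
  forall p h, consistent F p0 p h ->
    ~ atom_clash p /\ (II_to_move p -> moveII p (F (p :: h))).

Definition II_wins (p0 : position) : Prop := exists F, winning F p0.

End Game.

Definition wbisim Ag At (M M' : relmodel Ag At) (w : world M) (w' : world M')
    : Prop :=
  II_wins (@WPos _ _ (star M) (star M') w w').

Definition sbisim Ag At (M M' : relmodel Ag At) (s : state M) (s' : state M')
    : Prop :=
  (forall w, worlds_of s w -> exists2 w', worlds_of s' w' & wbisim w w') /\
  (forall w', worlds_of s' w' -> exists2 w, worlds_of s w & wbisim w w').

(* Properties are given on all pointed models; every notion below only depends
   on their restriction to the class at hand. *)
Definition wprop (Ag At : Type) := forall M : relmodel Ag At, world M -> Prop.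
Definition sprop (Ag At : Type) := forall M : relmodel Ag At, state M -> Prop.

Section Properties.
Variables (Ag At : Type) (C : model_class).
Implicit Types (P : wprop Ag At) (Q : sprop Ag At) (M : relmodel Ag At).

Definition w_inq_definable P : Prop :=
  exists f : inqml Ag At, forall M (w : world M), in_class C M ->
    (P M w <-> @true_at _ _ (star M) w f).

Definition s_inq_definable Q : Prop :=
  exists f : inqml Ag At, forall M (s : state M), in_class C M ->
    (Q M s <-> @support _ _ (star M) (worlds_of s) f).

Definition w_fo_definable P : Prop :=
  exists f : fo Ag At 1 0, forall M (w : world M), in_class C M ->
    (P M w <-> sat f [tuple w] [tuple]).

Definition s_fo_definable Q : Prop :=
  exists f : fo Ag At 0 1, forall M (s : state M), in_class C M ->
    (Q M s <-> sat f [tuple] [tuple s]).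

Definition w_invariant P : Prop :=
  forall M M' (w : world M) (w' : world M'), in_class C M -> in_class C M' ->
    wbisim w w' -> (P M w <-> P M' w').

Definition s_invariant Q : Prop :=
  forall M M' (s : state M) (s' : state M'), in_class C M -> in_class C M' ->
    sbisim s s' -> (Q M s <-> Q M' s').

Definition downward_closed Q : Prop :=
  forall M (s t : state M), in_class C M -> Q M s ->
    worlds_of t `<=` worlds_of s -> Q M t.

(* Every InqML formula is supported by the empty state, so the
   property that holds of no state-pointed model, though first-order definable,
   vacuously downward closed and invariant, is not InqML-definable. *)
Definition nonempty_sprop Q : Prop :=
  exists M (s : state M), in_class C M /\ Q M s.

End Properties.

(* Main.v *)
(* The easy directions go through resolutions: every formula is equivalent to an
   inquisitive disjunction of finitely many flat (worldwise) first-order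
   properties, and support is bisimulation invariant.

   For the converse, let a first-order formula of quantifier rank [q] define an
   invariant property. It mentions finitely many agents and atoms, and it does
   not notice when the other ones are made trivial, so that bisimulation types
   of finite depth become finite in number and definable in InqML. It remains to
   see that the property only depends on the type of some depth [l + 1]. Unravel
   the model from the distinguished worlds into a tree of depth [l] and glue the
   leaves to a copy of the model itself: the result is bisimilar to the original
   model, is finite if the original is, and can be made locally full. Cutting the
   tree off at its leaves instead changes nothing within distance [l] of the
   root, so if both versions are placed beside enough disjoint copies of both,
   they are indistinguishable in the Ehrenfeucht-Fraïssé game with [q] rounds,
   provided [l] is large enough. Finally, the bisimulation type of the cut-off
   tree is determined by the type of depth [l + 1] of its root. *)

From mathcomp Require Import all_boot zify.
From mathcomp Require Import boolp classical_sets cardinality.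
Require Import Defs.

Set Implicit Arguments.
Unset Strict Implicit.
Unset Printing Implicit Defensive.

Local Open Scope classical_set_scope.

(** * Bisimulations *)

(** The Egli-Milner lifting of [Z] to sets, which is what a state position of the game demands. *)
Definition matched (X Y : Type) (Z : X -> Y -> Prop) (s : set X) (t : set Y) :=
  (forall x, s x -> exists2 y, t y & Z x y) /\
  (forall y, t y -> exists2 x, s x & Z x y).

Lemma matched_flip (X Y : Type) (Z : X -> Y -> Prop) s t :
  matched Z s t -> matched (fun y x => Z x y) t s.
Proof. by case. Qed.

Definition bisimulation Ag At (M M' : inqmodel Ag At)
    (Z : iworld M -> iworld M' -> Prop) :=
  forall w w', Z w w' ->
  [/\ forall i, iV i w <-> iV i w',
      forall a s, iSigma a w s -> exists2 s', iSigma a w' s' & matched Z s s' &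
      forall a s', iSigma a w' s' -> exists2 s, iSigma a w s & matched Z s s'].

Lemma bisimulation_flip Ag At (M M' : inqmodel Ag At)
    (Z : iworld M -> iworld M' -> Prop) :
  bisimulation Z -> bisimulation (fun w' w => Z w w').
Proof.
move=> bZ w' w /bZ[V forth back]; split=> [i|a s /back|a s /forth].
- by rewrite V.
- by case=> t ? /matched_flip; exists t.
- by case=> t ? /matched_flip; exists t.
Qed.

Section GameBisimulation.
Variables (Ag At : Type) (M M' : inqmodel Ag At).
Implicit Types (p q : position M M') (F : strategy M M').

Section FromBisimulation.
Variable Z : iworld M -> iworld M' -> Prop.
Hypothesis bZ : bisimulation Z.

(** The invariant of II's play: at II's turn it asks that an answer restoring it exists. *)
Let good p : Prop :=
  match p with
  | WPos w w' => Z w w'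
  | WAnsL a s w' => exists2 s', iSigma a w' s' & matched Z s s'
  | WAnsR a w s' => exists2 s, iSigma a w s & matched Z s s'
  | SPos s s' => matched Z s s'
  | SAnsL w s' => exists2 w', s' w' & Z w w'
  | SAnsR s w' => exists2 w, s w & Z w w'
  end.

Lemma bisimulation_II_wins w w' : Z w w' -> II_wins (@WPos _ _ M M' w w').
Proof.
move=> Zw; have /choice[F FP] : forall p, exists q,
    good p -> II_to_move p -> moveII p q /\ good q.
  move=> p; case: (pselect (good p /\ II_to_move p)) => [[]|np]; last first.
    by exists p => gp mp; case: np.
  case: p => //=.
  - by move=> a s v' [s' ? ?] _; exists (SPos s s') => _ _; split=> //; constructor.
  - by move=> a v s' [s ? ?] _; exists (SPos s s') => _ _; split=> //; constructor.
  - by move=> v s' [v' ? ?] _; exists (@WPos _ _ M M' v v') => _ _; split=> //; constructor.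
  - by move=> s v' [v ? ?] _; exists (@WPos _ _ M M' v v') => _ _; split=> //; constructor.
(* The strategy is positional; its value at the empty history is never consulted. *)
pose G : strategy M M' := fun h => if h is p :: _ then F p else @WPos _ _ M M' w w'.
exists G => p h cph.
have gp : good p.
  elim: cph => //= {p h} [p q h _ gp mv | p h _ gp mv].
    case: mv gp => //=.
    - by move=> a v v' s Ss /bZ[_ forth _]; apply: forth.
    - by move=> a v v' s Ss /bZ[_ _ back]; apply: back.
    - by move=> s s' v sv [forth _]; apply: forth.
    - by move=> s s' v sv [_ back]; apply: back.
  by apply: (FP _ gp _).2; case: mv.
split; last by move=> /(FP p gp)[].
by case: p gp {cph} => [v v' /bZ[V _ _]|||||] *; apply.
Qed.

End FromBisimulation.

(** Histories of the residual game from [q] become histories of the original game once [p] is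
    appended as the oldest position. *)
Lemma winning_shift F p q :
  consistent F p q [:: p] -> winning F p -> winning (fun h => F (h ++ [:: p])) q.
Proof.
move=> cq wF r h c.
suff : consistent F p r (h ++ [:: p]) by move/wF.
elim: c => //= {r h} [r t h _ IH mv|r h _ IH mv].
  exact: ConsistentI IH mv.
exact: ConsistentII IH mv.
Qed.

Lemma II_wins_moveI p q : II_wins p -> moveI p q -> II_wins q.
Proof.
move=> [F wF] mv; exists (fun h => F (h ++ [:: p])); apply: winning_shift => //.
exact: ConsistentI (ConsistentStart _ _) mv.
Qed.

Lemma II_wins_moveII p :
  II_wins p -> II_to_move p -> exists2 q, moveII p q & II_wins q.
Proof.
move=> [F wF] tm; have [_ /(_ tm) mv] := wF p [::] (ConsistentStart _ _).
exists (F [:: p]) => //; exists (fun h => F (h ++ [:: p])).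
by apply: winning_shift => //; apply: ConsistentII (ConsistentStart _ _) mv.
Qed.

Lemma II_wins_SPos s s' : II_wins (@SPos _ _ M M' s s') ->
  matched (fun w w' => II_wins (@WPos _ _ M M' w w')) s s'.
Proof.
move=> win; split=> [w sw|w' sw'].
- have [//|q mv winq] := II_wins_moveII (II_wins_moveI win (MoveSL s' sw)).
  by inversion mv; subst; exists w'.
- have [//|q mv winq] := II_wins_moveII (II_wins_moveI win (MoveSR s sw')).
  by inversion mv; subst; exists w.
Qed.

(** Winning survives a move of I followed by II's winning answer, so the winning world positions
    satisfy the back-and-forth clauses. *)
Lemma II_wins_bisimulation :
  bisimulation (fun w w' => II_wins (@WPos _ _ M M' w w')).
Proof.
move=> w w' win; split=> [|a s Ss|a s' Ss'].
- case: (win) => F /(_ _ _ (ConsistentStart _ _))[+ _].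
  exact: contrapT.
- have [//|q mv winq] := II_wins_moveII (II_wins_moveI win (MoveWL w' Ss)).
  by inversion mv; subst; exists s' => //; apply: II_wins_SPos.
- have [//|q mv winq] := II_wins_moveII (II_wins_moveI win (MoveWR w Ss')).
  by inversion mv; subst; exists s => //; apply: II_wins_SPos.
Qed.

End GameBisimulation.

Lemma support_bisimulation Ag At (f : inqml Ag At) :
  forall (M M' : inqmodel Ag At) (Z : iworld M -> iworld M' -> Prop),
  bisimulation Z -> forall s s', matched Z s s' -> support s f -> support s' f.
Proof.
elim: f => [i||f IHf g IHg|f IHf g IHg|f IHf g IHg|a f IH|a f IH]
    M M' Z bZ s s' mss' /=.
- by move=> sV w' /mss'.2[w /sV Vw /bZ[V _ _]]; apply/V.
- move=> s0; apply/seteqP; split=> // w' /mss'.2[w].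
  by rewrite s0.
- by case=> [/(IHf _ _ _ bZ _ _ mss') ? /(IHg _ _ _ bZ _ _ mss')].
- move=> imp t' t's' t'f.
  (* The part of [s] related to [t']; it matches [t'] because every world of [t'] has a partner in
     [s]. The antecedent is then carried back along the flipped relation. *)
  pose t := [set w | s w /\ exists2 w', t' w' & Z w w'].
  have mt : matched Z t t'.
    split=> [w [] //|w' t'w'].
    by have [w sw Zw] := mss'.2 _ (t's' _ t'w'); exists w => //; split=> //; exists w'.
  apply: (IHg _ _ _ bZ _ _ mt); apply: imp => [w []//|].
  exact: (IHf _ _ _ (bisimulation_flip bZ) _ _ (matched_flip mt)).
- by case=> [/(IHf _ _ _ bZ _ _ mss')|/(IHg _ _ _ bZ _ _ mss')]; [left|right].
- move=> sf w' /mss'.2[w sw Zw]; apply: (IH _ _ _ bZ _ _ _ (sf w sw)).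
  have [_ forth back] := bZ _ _ Zw.
  split=> [v [t St tv]|v' [t' St' tv']].
    have [t' St' mt] := forth _ _ St.
    by have [v' tv' Zv] := mt.1 _ tv; exists v' => //; exists t'.
  have [t St mt] := back _ _ St'.
  by have [v tv Zv] := mt.2 _ tv'; exists v => //; exists t.
- move=> sf w' /mss'.2[w sw Zw] t' St'.
  have [_ _ back] := bZ _ _ Zw.
  have [t St mt] := back _ _ St'.
  exact: (IH _ _ _ bZ _ _ mt (sf w sw t St)).
Qed.

Lemma support_matched_wbisim Ag At (M M' : relmodel Ag At)
    (s : set (world M)) (s' : set (world M')) f :
  matched (@wbisim _ _ M M') s s' ->
  @support _ _ (star M) s f <-> @support _ _ (star M') s' f.
Proof.
move=> m; have bZ := @II_wins_bisimulation _ _ (star M) (star M').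
split; first exact: (support_bisimulation bZ).
exact: (support_bisimulation (bisimulation_flip bZ) (matched_flip m)).
Qed.

(** * From InqML to first-order logic *)

Section FirstOrder.
Variables (Ag At : Type).

Definition fo_expressible m n (D : forall M : relmodel Ag At,
    m.-tuple (world M) -> n.-tuple (state M) -> Prop) :=
  exists f : fo Ag At m n, forall M u v, sat f u v <-> D M u v.

(** Asking for a formula at every variable of every context replaces renaming and weakening of de
    Bruijn formulae. *)
Definition fo_world_property (D : wprop Ag At) :=
  forall m n (x : 'I_m),
    @fo_expressible m n (fun M u _ => D M (tnth u x)).

Section Closure.
Variables m n : nat.
Implicit Types D : forall M : relmodel Ag At,
  m.-tuple (world M) -> n.-tuple (state M) -> Prop.

Lemma fo_ext D D' : (forall M u v, D M u v <-> D' M u v) ->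
  fo_expressible D -> fo_expressible D'.
Proof. by move=> DD' [f fP]; exists f => M u v; rewrite fP. Qed.

Lemma fo_false : @fo_expressible m n (fun _ _ _ => False).
Proof. by exists (FBot _ _ _ _). Qed.

Lemma fo_imp D D' : fo_expressible D -> fo_expressible D' ->
  fo_expressible (fun M u v => D M u v -> D' M u v).
Proof. by move=> [f fP] [g gP]; exists (FImp f g) => M u v /=; rewrite fP gP. Qed.

Lemma fo_not D : fo_expressible D -> fo_expressible (fun M u v => ~ D M u v).
Proof. by move=> Dd; apply: fo_imp Dd fo_false. Qed.

Lemma fo_and D D' : fo_expressible D -> fo_expressible D' ->
  fo_expressible (fun M u v => D M u v /\ D' M u v).
Proof.
move=> Dd D'd; apply: (fo_ext _ (fo_not (fo_imp Dd (fo_not D'd)))) => M u v.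
split=> [nDD'|[? ?]]; last exact.
by split; apply: contrapT => ?; apply: nDD'.
Qed.

Lemma fo_forall_fin (I : finType) (D : I -> forall M : relmodel Ag At,
    m.-tuple (world M) -> n.-tuple (state M) -> Prop) :
  (forall i, fo_expressible (D i)) ->
  fo_expressible (fun M u v => forall i, D i M u v).
Proof.
move=> Dd.
suff [f fP] : fo_expressible (fun M u v => forall i, i \in enum I -> D i M u v).
  by exists f => M u v; rewrite fP; split=> h i *; apply: h; rewrite ?mem_enum.
elim: (enum I) => [|i s IH].
  by apply: (fo_ext _ (fo_not fo_false)) => M u v; split=> // _; apply.
apply: (fo_ext _ (fo_and (Dd i) IH)) => M u v; split.
  by move=> [Di Ds] j; rewrite inE => /orP[/eqP->|/Ds].
move=> Ds; split=> [|j js]; apply: Ds; rewrite inE ?eqxx //.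
by rewrite js orbT.
Qed.

Lemma fo_exists_fin (I : finType) (D : I -> forall M : relmodel Ag At,
    m.-tuple (world M) -> n.-tuple (state M) -> Prop) :
  (forall i, fo_expressible (D i)) ->
  fo_expressible (fun M u v => exists i, D i M u v).
Proof.
move=> Dd.
have nDd i : fo_expressible (fun M u v => ~ D i M u v) by apply: fo_not.
apply: (fo_ext _ (fo_not (fo_forall_fin nDd))) => M u v; split.
  by move/existsNP => [i /contrapT ?]; exists i.
by move=> [i Di] /(_ i).
Qed.

Lemma fo_forallW (D : forall M : relmodel Ag At,
    m.+1.-tuple (world M) -> n.-tuple (state M) -> Prop) :
  fo_expressible D ->
  fo_expressible (fun M u v => forall w, D M [tuple of w :: u] v).
Proof. by move=> [f fP]; exists (FAllW f) => M u v; split=> h w; apply/fP/h. Qed.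

End Closure.

Lemma fo_all_in m n (D : wprop Ag At) (y : 'I_n) : fo_world_property D ->
  @fo_expressible m n
    (fun M u v => forall w, worlds_of (tnth v y) w -> D M w).
Proof.
move=> /(_ m.+1 n ord0) Dd.
have eD : @fo_expressible m.+1 n
    (fun M u v => worlds_of (tnth v y) (tnth u ord0)).
  by exists (Feps _ _ ord0 y).
have [f fP] := fo_forallW (fo_imp eD Dd); exists f => M u v; rewrite fP.
by split=> h w; have := h w; rewrite tnth0.
Qed.

Lemma fo_all_accessible (D : wprop Ag At) a : fo_world_property D ->
  fo_world_property (fun M w => forall v, accessible a w v -> D M v).
Proof.
move=> Dd m n x.
have [f fP] := fo_all_in m (ord0 : 'I_n.+1) Dd.
exists (FAllS (FImp (FE _ a x ord0) f)) => M u v /=.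
split=> [h w [s Es sw]|h s]; last first.
  by rewrite fP !tnth0 => Es w sw; apply: h; exists s.
by have := h s; rewrite fP !tnth0; apply.
Qed.

Lemma fo_window (I : finType) (D : I -> wprop Ag At) a :
  (forall i, fo_world_property (D i)) ->
  fo_world_property (fun M w => forall s, rE a w s ->
    exists i, forall v, worlds_of s v -> D i M v).
Proof.
move=> Dd m n x.
have Ed i := fo_all_in m (ord0 : 'I_n.+1) (Dd i).
have [f fP] := fo_exists_fin Ed.
exists (FAllS (FImp (FE _ a x ord0) f)) => M u v /=.
by split=> h s; have := h s; rewrite fP !tnth0.
Qed.

(* The flat properties [D i] play the role of the resolutions of [f]: their
   inquisitive disjunction is equivalent to [f]. Translating worldwise in this
   way is necessary, as [isigma a w] need not be coded by a state. *)
Lemma inqml_resolutions (f : inqml Ag At) :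
  exists (I : finType) (D : I -> wprop Ag At),
    (forall i, fo_world_property (D i)) /\
    forall (M : relmodel Ag At) (s : set (world M)),
      @support _ _ (star M) s f <-> exists i, forall w, s w -> D i M w.
Proof.
elim: f => [p||f [I [D [Dd DP]]] g [J [E [Ed EP]]]
  |f [I [D [Dd DP]]] g [J [E [Ed EP]]]|f [I [D [Dd DP]]] g [J [E [Ed EP]]]
  |a f [I [D [Dd DP]]]|a f [I [D [Dd DP]]]].
- exists unit, (fun _ M w => rP p w); split=> [_ m n x|M s].
    by exists (FP _ _ p x).
  by split=> [sV|[_ sV]]; [exists tt|].
- exists unit, (fun _ M w => False); split=> [_ m n x|M s]; first exact: fo_false.
  split=> /= [->|[_ s0]]; first by exists tt.
  by apply/seteqP; split=> // w /s0.
- exists (I * J)%type, (fun ij M w => D ij.1 M w /\ E ij.2 M w); split.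
    by move=> ij m n x; apply: fo_and; [apply: Dd|apply: Ed].
  move=> M s /=; rewrite DP EP; split=> [[[i Di] [j Ej]]|[[i j] /= h]].
    by exists (i, j) => w sw; split; [apply: Di|apply: Ej].
  by split; [exists i|exists j] => w /h[].
(* A function [h] picks a resolution of [g] for each one of [f]. It is read off at the largest
   subset of [s] satisfying [D i], which serves all smaller ones. *)
- exists {ffun I -> J}, (fun (h : {ffun I -> J}) M w => forall i, D i M w -> E (h i) M w); split.
    by move=> h m n x; apply: fo_forall_fin => i; apply: fo_imp; [apply: Dd|apply: Ed].
  move=> M s /=; split=> [imp|[h hP] t ts /DP[i Di]]; last first.
    by apply/EP; exists (h i) => w tw; apply: hP (ts _ tw) _ (Di _ tw).
  have /choice[h hP] : forall i, exists j, forall w, s w -> D i M w -> E j M w.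
    move=> i; pose t := [set w | s w /\ D i M w].
    have /EP[j Ej] : @support _ _ (star M) t g.
      by apply: imp => [w []//|]; apply/DP; exists i => w [].
    by exists j => w sw Dw; apply: Ej.
  by exists [ffun i => h i] => w sw i; rewrite ffunE; apply: hP.
- exists (I + J)%type, (fun ij => match ij with inl i => D i | inr j => E j end).
  split=> [[i|j]|M s /=]; [exact: Dd|exact: Ed|rewrite DP EP].
  split=> [[[i Di]|[j Ej]]|[[i|j] h]]; [by exists (inl i)|by exists (inr j)| |].
    by left; exists i.
  by right; exists j.
(* Modal formulae are checked world by world, so a single property suffices and the choice of a
   resolution moves inside it. *)
- exists unit, (fun _ M w => exists i, forall v, accessible a w v -> D i M v).
  split=> [_ m n x|M s /=].
    by apply: fo_exists_fin => i; apply: fo_all_accessible.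
  have sE w : @isigma _ _ (star M) a w = accessible a w.
    apply/seteqP; split=> v; first by move=> [_ [s' Es <-] s'v]; exists s'.
    by move=> [s' Es s'v]; exists (worlds_of s') => //; exists s'.
  split=> [h|[_ h] w sw]; last by rewrite sE; apply/DP/h.
  by exists tt => w /h; rewrite sE => /DP.
- exists unit, (fun _ M w => forall s, rE a w s ->
    exists i, forall v, worlds_of s v -> D i M v).
  split=> [_|M s /=]; first exact: fo_window.
  split=> [h|[_ h] w sw _ [t Et <-]]; last by apply/DP; exact: h w sw t Et.
  by exists tt => w sw t Et; apply/DP/(h w sw); exists t.
Qed.

Lemma w_inq_fo C (P : wprop Ag At) : w_inq_definable C P -> w_fo_definable C P.
Proof.
move=> [f fP]; have [I [D [Dd DP]]] := inqml_resolutions f.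
have [g gP] := fo_exists_fin (fun i => Dd i 1 0 ord0).
exists g => M w MC; rewrite fP // gP.
have -> : tnth [tuple w] ord0 = w by [].
split=> [/DP[i Di]|[i Di]]; first by exists i; exact: Di w erefl.
by apply/DP; exists i => _ ->.
Qed.

Lemma s_inq_fo C (Q : sprop Ag At) : s_inq_definable C Q -> s_fo_definable C Q.
Proof.
move=> [f fP]; have [I [D [Dd DP]]] := inqml_resolutions f.
have [g gP] := fo_exists_fin (fun i => fo_all_in 0 (ord0 : 'I_1) (Dd i)).
by exists g => M s MC; rewrite fP // gP; apply: DP.
Qed.

End FirstOrder.

Lemma w_inq_invariant Ag At C (P : wprop Ag At) :
  w_inq_definable C P -> w_invariant C P.
Proof.
move=> [f fP] M M' w w' MC M'C ww'; rewrite !fP //.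
by apply: support_matched_wbisim; split=> _ ->; [exists w'|exists w].
Qed.

Lemma s_inq_invariant Ag At C (Q : sprop Ag At) :
  s_inq_definable C Q -> s_invariant C Q.
Proof.
by move=> [f fP] M M' s s' MC M'C ss'; rewrite !fP //; apply: support_matched_wbisim.
Qed.

Lemma support_down Ag At (M : inqmodel Ag At) (s t : set (iworld M)) f :
  support s f -> t `<=` s -> support t f.
Proof.
elim: f s t => [i||f IHf g IHg|f IHf g IHg|f IHf g IHg|a f IH|a f IH] s t /=.
- by move=> sV ts; apply: subset_trans sV.
- by move=> -> ?; rewrite -subset0.
- by move=> [sf sg] ts; split; [apply: IHf ts|apply: IHg ts].
- by move=> sfg ts r rt; apply: sfg; apply: subset_trans ts.
- by move=> [sf|sg] ts; [left; apply: IHf ts|right; apply: IHg ts].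
- by move=> sf ts w /ts; apply: sf.
- by move=> sf ts w /ts; apply: sf.
Qed.

Lemma support_set0 Ag At (M : inqmodel Ag At) f : @support _ _ M set0 f.
Proof.
elim: f => [i||f IHf g IHg|f _ g IHg t|f IHf g _|a f _|a f _] //=; last by left.
by rewrite subset0 => ->.
Qed.

(** * Bisimulation types of finite depth *)

Section Colour.
Variables n m : nat.

Fixpoint colour_type (k : nat) : finType :=
  if k is k'.+1 then
    ({ffun 'I_m -> bool} *
     {ffun 'I_n -> {ffun {ffun colour_type k' -> bool} -> bool}})%type
  else unit.

Definition image_colour (W : Type) (T : finType) (c : W -> T) (t : set W) :
    {ffun T -> bool} :=
  [ffun x => `[< exists2 v, t v & c v = x >]].

(** The bisimulation type of depth [k]. Depth [0] sees nothing, not even atoms; these enter at depth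
    [1], which causes the shift to [l.+1] for trees of depth [l]. *)
Fixpoint colour (W : Type) (Sg : 'I_n -> W -> set (set W)) (V : 'I_m -> set W)
    (k : nat) : W -> colour_type k :=
  if k is k'.+1 return W -> colour_type k then fun w =>
    ([ffun i => `[< V i w >]],
     [ffun i => [ffun X =>
        `[< exists2 t, Sg i w t & image_colour (colour Sg V k') t = X >]]])
  else fun _ => tt.

(** Collecting colours of different models in one finite type turns matching into an equation. *)
Lemma image_colourP (W W' : Type) (T : finType) (c : W -> T) (c' : W' -> T) t t' :
  image_colour c t = image_colour c' t' <->
  matched (fun w w' => c w = c' w') t t'.
Proof.
split=> [/ffunP e|[tt' t't]]; last first.
  apply/ffunP => x; rewrite !ffunE; apply: asbool_equiv_eq.
  split=> -[v].
    by move=> /tt'[v' ? ->] ?; exists v'.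
  by move=> /t't[v' ? <-] ?; exists v'.
split=> v tv; [have := e (c v)|have := e (c' v)]; rewrite !ffunE.
  rewrite (asboolT (_ : exists2 _, _ & _)); last by exists v.
  by move=> /esym/asboolP[v' ? ?]; exists v'.
rewrite (asboolT (_ : exists2 w, t' w & c' w = _)); last by exists v.
by move=> /asboolP[v' ? ?]; exists v'.
Qed.

(** Only the forth half is stated; the back half is the same lemma for the reversed equation. *)
Lemma colourS (W W' : Type) (Sg : 'I_n -> W -> set (set W)) (V : 'I_m -> set W)
    (Sg' : 'I_n -> W' -> set (set W')) (V' : 'I_m -> set W') k w w' :
  colour Sg V k.+1 w = colour Sg' V' k.+1 w' ->
  (forall i, V i w <-> V' i w') /\
  (forall i t, Sg i w t -> exists2 t', Sg' i w' t' &
     matched (fun v v' => colour Sg V k v = colour Sg' V' k v') t t').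
Proof.
move=> /= [/ffunP eV /ffunP eS]; split=> i.
  by apply: asbool_eq_equiv; have := eV i; rewrite !ffunE.
move=> t St; have /ffunP/(_ (image_colour (colour Sg V k) t)) := eS i.
rewrite !ffunE (asboolT (_ : exists2 _, _ & _)); last by exists t.
by move=> /esym/asboolP[t' St' /esym/image_colourP]; exists t'.
Qed.

End Colour.

(** * Definability of finite types by flat formulae *)

Section Flat.
Variables (Ag At : Type).
Implicit Types (D : wprop Ag At).

Definition flat_definable D := exists f : inqml Ag At,
  forall (M : relmodel Ag At) (s : set (world M)),
    @support _ _ (star M) s f <-> forall w, s w -> D M w.

Lemma flat_ext D D' : (forall M w, D M w <-> D' M w) ->
  flat_definable D -> flat_definable D'.
Proof.
move=> DD' [f fP]; exists f => M s; rewrite fP.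
by split=> h w /h /DD'.
Qed.

Lemma flat_true D : (forall M w, D M w) -> flat_definable D.
Proof.
move=> DT; exists (IImp (IBot _ _) (IBot _ _)) => M s /=; split=> [_ w _|_ t _ //].
exact: DT.
Qed.

Lemma flat_not D : flat_definable D -> flat_definable (fun M w => ~ D M w).
Proof.
move=> [f fP]; exists (IImp f (IBot _ _)) => M s /=; split=> [h w sw Dw|h t ts].
  have : [set w] = set0 :> set (world M).
    by apply: h => [_ ->//|]; apply/fP => _ ->.
  by move/seteqP => [/(_ w erefl)].
by move=> /fP tD; apply/seteqP; split=> // w /[dup] /tD Dw /ts /h.
Qed.

Lemma flat_forall (I : finType) (D : I -> wprop Ag At) :
  (forall i, flat_definable (D i)) ->
  flat_definable (fun M w => forall i, D i M w).
Proof.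
move=> Dd.
suff : flat_definable (fun M w => forall i, i \in enum I -> D i M w).
  by apply: flat_ext => M w; split=> h i *; apply: h; rewrite ?mem_enum.
elim: (enum I) => [|i s [f fP]].
  exact: flat_true.
have [g gP] := Dd i; exists (IAnd g f) => M t /=; rewrite gP fP.
split=> [[Di Ds] w tw j|h].
  by rewrite inE => /orP[/eqP->|]; [apply: Di|apply: Ds].
by split=> w tw; [|move=> j js]; apply: h; rewrite ?inE ?eqxx ?js ?orbT.
Qed.

(** Inquisitive disjunction is not flat, so membership in [X] is expressed as a conjunction
    excluding every value outside [X]. *)
Lemma flat_mem D (T : finType) (c : forall M : relmodel Ag At, world M -> T) :
  (forall x, flat_definable (fun M w => c M w = x)) ->
  forall X : pred T, flat_definable (fun M w => X (c M w)).
Proof.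
move=> cd X.
have : forall x, flat_definable (fun M w => ~~ X x -> c M w <> x).
  move=> x; case: (X x); last first.
    by apply: flat_ext (flat_not (cd x)) => M w; split=> // /(_ isT).
  exact: flat_true.
move/flat_forall; apply: flat_ext => M w; split=> [h|Xc x nX cx].
  by apply: contraT => /h.
by rewrite -cx Xc in nX.
Qed.

(** The clause for the empty set stems from [IBot], the empty disjunction. *)
Lemma inq_disjunction (T : finType) (X : pred T) (g : T -> inqml Ag At) :
  exists h : inqml Ag At, forall (M : inqmodel Ag At) (s : set (iworld M)),
    support s h <-> s = set0 \/ exists2 x, X x & support s (g x).
Proof.
suff [h hP] : exists h : inqml Ag At,
    forall (M : inqmodel Ag At) (s : set (iworld M)), support s h <->
      s = set0 \/ exists2 x, x \in enum X & support s (g x).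
  exists h => M s; rewrite hP; split=> -[|[x Xx ?]]; [by left| |by left|].
    by right; exists x => //; rewrite mem_enum in Xx.
  by right; exists x => //; rewrite mem_enum.
elim: (enum X) => [|x r [h hP]].
  by exists (IBot _ _) => M s /=; split=> [|[|[]]//]; left.
exists (IOr (g x) h) => M s /=; rewrite hP; split.
  move=> [?|[?|[y yr ?]]]; [|by left|]; right; [exists x|exists y] => //.
    by rewrite mem_head.
  by rewrite inE yr orbT.
move=> [?|[y + sy]]; first by right; left.
rewrite inE => /orP[/eqP yx|yr]; first by left; rewrite -yx.
by right; right; exists y.
Qed.

Section ModelColour.
Variables (n m : nat) (act : 'I_n -> Ag) (at_ : 'I_m -> At).

Definition mcolour k (M : relmodel Ag At) : world M -> colour_type n m k :=
  colour (fun i => @star_Sigma _ _ M (act i)) (fun i => @rP _ _ M (at_ i)) k.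

Lemma mcolourS k (M M' : relmodel Ag At) (w : world M) (w' : world M') :
  mcolour k.+1 w = mcolour k.+1 w' ->
  (forall i, rP (at_ i) w <-> rP (at_ i) w') /\
  (forall i t, star_Sigma (act i) w t -> exists2 t', star_Sigma (act i) w' t' &
     matched (fun v v' => mcolour k v = mcolour k v') t t').
Proof. exact: colourS. Qed.

(* As [star_Sigma a w] is downward closed, attaining the colour set [X] exactly
   is the same as attaining at least [X]. *)
Lemma flat_exists_image (T : finType) (c : forall M : relmodel Ag At, world M -> T)
    a (X : {ffun T -> bool}) :
  (forall x, flat_definable (fun M w => c M w = x)) ->
  flat_definable (fun M w =>
    exists2 t, star_Sigma a w t & image_colour (c M) t = X).
Proof.
(* If [X] is empty, the empty set is a witness at every world. The disjunction used below would
   wrongly exclude it, as the empty set supports every formula. *)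
move=> cd; case: (pselect (exists x, X x)) => [[x0 Xx0]|X0]; last first.
  apply: flat_true => M w.
  have [t St] := star_Sigma_neq0 a w.
  exists set0; first exact: star_Sigma_down St _.
  apply/ffunP => x; rewrite ffunE asboolF; last by case.
  by apply/esym/negbTE/negP => Xx; apply: X0; exists x.
have /choice[g gP] := fun x => flat_not (cd x).
(* A non-empty set supports [h] when it misses some colour of [X]; refuting the window of [h]
   therefore yields a set that meets all of [X]. *)
have [h hP] := inq_disjunction X g.
have : flat_definable (fun M w => forall t, star_Sigma a w t ->
    @support _ _ (star M) t h).
  exists (IWindow a h) => M s /=; split=> hs w sw t; last exact: hs.
  exact: hs.
move/flat_not; apply: flat_ext => M w; split.
  move=> nh; apply: contrapT => nX; apply: nh => t St; apply/hP.
  apply: contrapT => /not_orP[t0 nt]; apply: nX.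
  exists [set v | t v /\ X (c M v)].
    by apply: (star_Sigma_down St) => v [].
  apply/ffunP => x; rewrite ffunE; case Xx : (X x); last first.
    by apply: asboolF => -[v [_ Xc] cx]; rewrite cx Xx in Xc.
  apply: asboolT; apply: contrapT => nv; apply: nt; exists x => //.
  by apply/gP => v tv cx; apply: nv; exists v => //; split=> //; rewrite cx.
move=> [t St tX] /(_ t St)/hP; rewrite -tX => -[t0|[x]].
  by move: Xx0; rewrite -tX ffunE => /asboolP[v]; rewrite t0.
by rewrite ffunE => /asboolP[v tv cv] /gP /(_ v tv).
Qed.

Lemma flat_bool D (b : bool) : flat_definable D ->
  flat_definable (fun M w => `[< D M w >] = b).
Proof.
case: b => Dd; first by apply: flat_ext Dd => M w; split=> /asboolP.
by apply: flat_ext (flat_not Dd) => M w; split=> [/asboolF|/asboolPn]// /negbT/asboolPn.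
Qed.

Lemma flat_colour k (x : colour_type n m k) :
  flat_definable (fun M w => mcolour k w = x).
Proof.
elim: k x => [|k IH] /=.
  by case; apply: flat_true.
move=> [al be].
have Dal : flat_definable (fun M w => forall i, `[< @rP _ _ M (at_ i) w >] = al i).
  by apply: flat_forall => i; apply: flat_bool; exists (IAtom _ (at_ i)) => M s.
have Dbe : flat_definable (fun M w => forall i, forall X,
    `[< exists2 t, star_Sigma (act i) w t & image_colour (@mcolour k M) t = X >]
      = be i X).
  apply: flat_forall => i; apply: flat_forall => X; apply: flat_bool.
  exact: flat_exists_image.
(* A binary conjunction written as a quantifier over [bool], so that [flat_forall] applies. *)
have : flat_definable (fun M w => forall b : bool, if b then
    forall i, `[< @rP _ _ M (at_ i) w >] = al i else forall i, forall X,
    `[< exists2 t, star_Sigma (act i) w t & image_colour (@mcolour k M) t = X >]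
      = be i X).
  by apply: flat_forall; case.
apply: flat_ext => M w; split=> [h|[hal hbe]].
  congr pair; first by apply/ffunP => i; rewrite ffunE (h true).
  by apply/ffunP => i; apply/ffunP => X; rewrite !ffunE (h false).
by case=> [i|i X]; [rewrite -hal ffunE|rewrite -hbe !ffunE].
Qed.

(** There are finitely many colours, each definable, so a property decided by the colour is
    membership in a definable finite set. *)
Lemma w_definable_colour C (P : wprop Ag At) k :
  (forall M M' (w : world M) (w' : world M'), in_class C M -> in_class C M' ->
     mcolour k w = mcolour k w' -> (P M w <-> P M' w')) ->
  w_inq_definable C P.
Proof.
move=> Pk.
pose X : pred (colour_type n m k) := fun x =>
  `[< exists M (w : world M), [/\ in_class C M, P M w & mcolour k w = x] >].
have [f fP] := flat_mem (fun _ _ => True) (@flat_colour k) X.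
exists f => M w MC; rewrite /true_at fP; split=> [Pw _ ->|/(_ w erefl)].
  by apply/asboolP; exists M, w.
by move=> /asboolP[M' [w' [M'C Pw' e]]]; apply: (Pk _ _ _ _ MC M'C (esym e)).2.
Qed.

(** The formula says that the colours of [s] lie among those of some state with [Q]. Then [s] has
    the same colours as a part of that state, and downward closure passes [Q] to the part. *)
Lemma s_definable_colour C (Q : sprop Ag At) k :
  downward_closed C Q -> nonempty_sprop C Q ->
  (forall M M' (s : state M) (s' : state M'), in_class C M -> in_class C M' ->
     image_colour (@mcolour k M) (worlds_of s) =
     image_colour (@mcolour k M') (worlds_of s') -> (Q M s <-> Q M' s')) ->
  s_inq_definable C Q.
Proof.
move=> Qd [M0 [s0 [M0C Qs0]]] Qk.
pose X : pred {ffun colour_type n m k -> bool} := fun x =>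
  `[< exists M (s : state M), [/\ in_class C M, Q M s &
     image_colour (@mcolour k M) (worlds_of s) = x] >].
have /choice[g gP] := fun x : {ffun colour_type n m k -> bool} =>
  flat_mem (fun _ _ => True) (@flat_colour k) x.
have [f fP] := inq_disjunction X g.
exists f => M s MC; rewrite fP; split=> [Qs|h].
  right; exists (image_colour (@mcolour k M) (worlds_of s)).
    by apply/asboolP; exists M, s.
  by apply/gP => w sw; rewrite ffunE; apply/asboolP; exists w.
(* An empty state supports the disjunction by default; [nonempty_sprop] then supplies the colour set
   in [X]. *)
have {h} [x /asboolP[M' [s' [M'C Qs' s'x]]] /gP xs] :
    exists2 x, X x & @support _ _ (star M) (worlds_of s) (g x).
  case: h => // ->; exists (image_colour (@mcolour k M0) (worlds_of s0)).
    by apply/asboolP; exists M0, s0.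
  exact: support_set0.
have [t tE] : exists t : state M', [set w' | worlds_of s' w' /\
    exists2 w, worlds_of s w & mcolour k w = mcolour k w'] = worlds_of t.
  by apply: (@state_down _ _ M' s') => w' [].
apply: (Qk _ _ s t MC M'C _).2; last first.
  by apply: Qd Qs' _ => //; rewrite -tE => w' [].
rewrite -tE; apply/image_colourP; split=> [w sw|w' [? [w sw e]]]; last by exists w.
have := xs w sw; rewrite -s'x ffunE => /asboolP[w' s'w' e].
by exists w' => //; split=> //; exists w.
Qed.

End ModelColour.
End Flat.

Lemma finite_powerset (T : Type) : finite_set [set: T] ->
  finite_set [set: set T].
Proof.
move=> fT; have [s sT] := (finite_seqP [set: {classic T}]).1 fT.
pose h (p : {ffun 'I_(size s) -> bool}) : set T :=
  [set tnth (in_tuple s) i | i in [set i | p i]].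
apply: (@sub_finite_set _ _ (range h)); last exact: finite_image.
move=> t _; exists [ffun i => `[< t (tnth (in_tuple s) i) >]] => //.
apply/seteqP; split=> [_ [i /= + <-]|x tx]; first by rewrite ffunE => /asboolP.
have xs : [set: {classic T}] x by [].
rewrite sT in xs; have /tnthP[i xi] : x \in in_tuple s by []; exists i => //=.
by rewrite ffunE; apply/asboolP; rewrite -xi.
Qed.

Lemma star_Sigma1 Ag At (M : relmodel Ag At) a (w v : world M) :
  accessible a w v -> star_Sigma a w [set v].
Proof.
move=> [s Es sv]; apply: (@star_Sigma_down _ _ M a w (worlds_of s)).
  by exists s.
by move=> _ ->.
Qed.

Lemma accessible_star Ag At (M : relmodel Ag At) a (w w' : world M) : epistemic M ->
  accessible a w w' -> star_Sigma a w = star_Sigma a w'.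
Proof.
by move=> /(_ a)[_ h] /h e; apply/seteqP; split=> _ [s /e Es <-]; exists s.
Qed.

Section Accessibility.
Variables (Ag At : Type) (N : relmodel Ag At).
Hypothesis Ne : epistemic N.

Lemma accessible_refl a (w : world N) : accessible a w w.
Proof. by have [[r _ _] _] := Ne a; apply: r. Qed.

Lemma accessible_sym a (w v : world N) : accessible a w v -> accessible a v w.
Proof. by have [[_ h _] _] := Ne a; apply: h. Qed.

Lemma accessible_trans a (u v w : world N) :
  accessible a u v -> accessible a v w -> accessible a u w.
Proof. by have [[_ _ h] _] := Ne a; apply: h. Qed.

Lemma accessible_eq a (w v : world N) :
  accessible a w v -> accessible a w = accessible a v.
Proof.
move=> wv; apply/seteqP; split=> x; apply: accessible_trans => //.
exact: accessible_sym.
Qed.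

Lemma star_Sigma_accessible a (w v : world N) (t : set (world N)) :
  star_Sigma a w t -> t v -> accessible a w v.
Proof. by move=> [s Es <-] sv; exists s. Qed.

End Accessibility.

(** * Frames over a model and their Ehrenfeucht-Fraïssé games *)

Section Frames.
Variables (Ag At : Type) (N : relmodel Ag At).

(* A presentation of an inquisitive model by a projection to [N]: the classes
   of agent [a] are the fibres of [fclass (Some a)], each of them split into
   (at most) two sides, and the elements of [Sigma_a] are the one-sided subsets
   of a class that project to an element of [Sigma_a] in [N]. The extra index
   [None] only contributes states (all subsets of its classes), so that the set
   of roots of an unravelling can be made a state. *)
Record frame := Frame {
  fworld : Type;
  fworld_inh : inhabited fworld;
  fid : Type;
  fclass : option Ag -> fworld -> fid;
  fside : Ag -> fworld -> bool;
  fpi : fworld -> world N;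
  fclass_accessible : forall a z z', fclass (Some a) z = fclass (Some a) z' ->
    accessible a (fpi z) (fpi z')
}.

Section FrameModel.
Variable F : frame.
Let W := fworld F.

Definition fSigma (a : Ag) (z : W) (t : set W) : Prop :=
  [/\ forall y, t y -> fclass (Some a) y = fclass (Some a) z,
      forall y y', t y -> t y' -> fside a y = fside a y' &
      star_Sigma a (fpi z) [set fpi y | y in t]].

(** A state lies inside one class, hence in a ball of radius one; a move to a state can then be
    treated like a move to a world. *)
Definition fstate_set (t : set W) : Prop :=
  exists g z, forall y, t y -> fclass g y = fclass g z.

Definition fstate := {t : set W | fstate_set t}.

Definition frE (a : Ag) (z : W) (s : fstate) := fSigma a z (sval s).

Definition feps (z : W) (s : fstate) : Prop := sval s z.

Lemma fstate_inh : inhabited fstate.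
Proof.
have [z] := fworld_inh F; constructor; exists set0.
by exists None, z.
Qed.

Lemma fstate_ext (s s' : fstate) : underl feps s = underl feps s' -> s = s'.
Proof.
by case: s s' => [s ps] [s' ps'] e; apply: eq_exist.
Qed.

Lemma fstate_down (s : fstate) (t : set W) : t `<=` underl feps s ->
  exists s', t = underl feps s'.
Proof.
move=> ts; have pt : fstate_set t.
  by case: (svalP s) => g [z h]; exists g, z => y /ts; apply: h.
by exists (exist _ t pt).
Qed.

Lemma fSigma_down a z (s t : set W) : fSigma a z s -> t `<=` s -> fSigma a z t.
Proof.
move=> [cl sd St] ts; split=> [y /ts /cl//|y y' /ts + /ts|]; first exact: sd.
by apply: star_Sigma_down St _ => _ [y /ts ? <-]; exists y.
Qed.

Lemma frE_neq0 a z : exists s, frE a z s.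
Proof.
have [g [w h]] : fstate_set set0 by have [w] := fworld_inh F; exists None, w.
exists (exist _ set0 (ex_intro _ g (ex_intro _ w h))); split=> //=.
have [s Ss] := star_Sigma_neq0 a (fpi z).
by apply: star_Sigma_down Ss _ => ? [].
Qed.

Lemma frE_down a z s s' : frE a z s -> underl feps s' `<=` underl feps s ->
  frE a z s'.
Proof. exact: fSigma_down. Qed.

Definition fmodel : relmodel Ag At :=
  RelModel (fun i => [set z : W | rP i (fpi z)]) (fworld_inh F) fstate_inh
    fstate_ext fstate_down frE_neq0 frE_down.

Lemma fmodel_state (t : set W) : fstate_set t ->
  exists s : state fmodel, worlds_of s = t.
Proof. by move=> pt; exists (exist _ t pt). Qed.

Lemma star_fmodel a (z : W) t : @star_Sigma _ _ fmodel a z t <-> fSigma a z t.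
Proof.
split=> [[s /= Es <-]//|St]; have [//|s sE] := @fmodel_state t.
  by case: St => cl _ _; exists (Some a), z.
by exists s => //=; rewrite /frE -[sval s]/(worlds_of s) sE.
Qed.

(** Singletons are one-sided, so splitting a class into sides does not split accessibility. *)
Lemma accessible_fmodel a (z z' : W) :
  @accessible _ _ fmodel a z z' <-> fclass (Some a) z = fclass (Some a) z'.
Proof.
split=> [[s [cl _ _] /cl ->//]|e].
have /star_fmodel[s Es sE] : fSigma a z [set z'].
  split=> [y ->//|y y' -> ->//|]; rewrite image_set1.
  exact/star_Sigma1/fclass_accessible.
by exists s => //; rewrite sE.
Qed.

(** Every subset of a class is a state by construction, whether or not [N] is locally full. *)
Lemma fmodel_locally_full : locally_full fmodel.
Proof.
move=> a w t ts; apply: fmodel_state; exists (Some a), w => y /ts.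
by move/accessible_fmodel.
Qed.

Lemma fmodel_epistemic : epistemic N -> epistemic fmodel.
Proof.
move=> Ne a; split; first split.
- by move=> z; apply/accessible_fmodel.
- by move=> z z' /accessible_fmodel ?; apply/accessible_fmodel.
- by move=> x y z /accessible_fmodel xy /accessible_fmodel yz;
    apply/accessible_fmodel; rewrite xy.
move=> z z' /accessible_fmodel e s.
have eS := accessible_star Ne (fclass_accessible e).
by split=> -[cl sd St]; split=> // [y /cl ->//|]; rewrite ?eS // -eS.
Qed.

Lemma fmodel_finite : finite_set [set: W] -> finite_model fmodel.
Proof.
move=> fW; split=> //.
have := finite_powerset fW.
have sI : {in (@sval _ fstate_set) @^-1` setT &, injective (@sval _ fstate_set)}.
  by move=> s s' _ _ e; apply: fstate_ext; apply: e.
by move/(finite_preimage sI); rewrite preimage_setT.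
Qed.

End FrameModel.
End Frames.

(** * Balls in the adjacency graph of a frame *)

Section Neighbourhoods.
Variables (Ag At : Type) (N : relmodel Ag At) (F : frame N).
Let W := fworld F.
Implicit Types X Y : set W.

Definition adjacent (x y : W) := exists g, fclass g x = fclass g y.

Lemma adjacent_refl x : adjacent x x.
Proof. by exists None. Qed.

Lemma adjacent_sym x y : adjacent x y -> adjacent y x.
Proof. by case=> g e; exists g. Qed.

Fixpoint nbhd k X : set W :=
  if k is k'.+1 then [set y | exists2 x, nbhd k' X x & adjacent x y] else X.

Lemma nbhd_add i k X : nbhd i (nbhd k X) = nbhd (i + k) X.
Proof.
by elim: i => //= i IH; rewrite IH.
Qed.

Lemma nbhd_mono k X Y : X `<=` Y -> nbhd k X `<=` nbhd k Y.
Proof. by move=> XY; elim: k => //= k IH y [x /IH Yx xy]; exists x. Qed.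

Lemma nbhd_le i k X : i <= k -> nbhd i X `<=` nbhd k X.
Proof.
move=> ik; rewrite -(subnK ik) -nbhd_add; elim: (k - i) => //= j IH x /IH ?.
by exists x => //; apply: adjacent_refl.
Qed.

Lemma nbhdU k X Y : nbhd k (X `|` Y) = nbhd k X `|` nbhd k Y.
Proof.
elim: k => //= k ->; apply/seteqP; split=> y.
  by move=> [x [Xx|Yx] xy]; [left|right]; exists x.
by move=> [[x ? ?]|[x ? ?]]; exists x => //; [left|right].
Qed.

Lemma nbhd_sym k x y : nbhd k [set x] y -> nbhd k [set y] x.
Proof.
elim: k y => [|k IH] y; first by move=> ->.
move=> [z /IH zx zy]; rewrite -addn1 -nbhd_add; apply: nbhd_mono zx => _ ->.
by exists y => //; apply: adjacent_sym.
Qed.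

(** A path of length [i] from [X], the edge from [x] to [y], and a path of length [k] to [z] would
    add up to [(i + k).+1]. *)
Lemma nbhd_far i k X x y z : ~ nbhd (i + k).+1 X z ->
  nbhd i X x -> nbhd k [set z] y -> ~ adjacent x y.
Proof.
move=> far Xx /nbhd_sym zy xy; apply: far.
rewrite addnC -addnS -nbhd_add; apply: nbhd_mono zy => _ ->.
by exists x.
Qed.

Lemma nbhd_component (J : Type) (comp : W -> J) :
  (forall x y, adjacent x y -> comp x = comp y) ->
  forall (L : set J) k X, (forall x, X x -> L (comp x)) ->
  forall x, nbhd k X x -> L (comp x).
Proof.
move=> compP L k X XL; elim: k => //= k IH y [x /IH Lx /compP <-] //.
Qed.

End Neighbourhoods.

(** * Local partial isomorphisms and their extension by one move *)

Section PartialIsomorphisms.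
Variables (Ag At : Type) (N : relmodel Ag At).
Implicit Types F : frame N.

(** Both frames lie over the same [N], so equal projections take care of the atoms and of [Sigma] in
    [N]. The third clause makes [r] an injective partial function. *)
Definition partial_iso F F' (r : fworld F -> fworld F' -> Prop) :=
  [/\ forall x x', r x x' -> fpi x = fpi x',
      forall a x x', r x x' -> fside a x = fside a x',
      forall x x' y y', r x x' -> r y y' -> (x = y <-> x' = y') &
      forall g x x' y y', r x x' -> r y y' ->
        (fclass g x = fclass g y <-> fclass g x' = fclass g y')].

Lemma partial_iso_flip F F' (r : fworld F -> fworld F' -> Prop) :
  partial_iso r -> partial_iso (fun x' x => r x x').
Proof.
case=> rpi rs re rc; split=> [x x' /rpi//|a x x' /rs//|x x' y y' xx' yy'|].
  by rewrite (re _ _ _ _ xx' yy').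
by move=> g x x' y y' xx' yy'; rewrite (rc _ _ _ _ _ xx' yy').
Qed.

Lemma partial_iso_adjacent F F' (r : fworld F -> fworld F' -> Prop) x x' y y' :
  partial_iso r -> r x x' -> r y y' -> adjacent x y -> adjacent x' y'.
Proof.
by move=> [_ _ _ rc] xx' yy' [g e]; exists g; apply/(rc g _ _ _ _ xx' yy').
Qed.

Lemma partial_iso_nbhd F F' (r : fworld F -> fworld F' -> Prop)
    (X : set (fworld F)) X' k y y' :
  partial_iso r -> (forall x, nbhd k X x -> exists x', r x x') ->
  (forall x, X x -> exists2 x', X' x' & r x x') ->
  r y y' -> nbhd k X y -> nbhd k X' y'.
Proof.
move=> pr; elim: k y y' => [|k IH] y y' dom XX' yy' /=.
  by move=> /XX'[x' X'x' yx']; have [_ _ /(_ _ _ _ _ yx' yy')[/(_ erefl) <-]] := pr.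
move=> [x Xx xy]; have [x' xx'] := dom x (nbhd_le (leqnSn _) Xx).
exists x'; last exact: partial_iso_adjacent pr xx' yy' xy.
by apply: (IH x) => // z Xz; apply: dom; apply: nbhd_le Xz.
Qed.

(** With [R] the radius for the remaining rounds, a near move lands within [2 * R + 2] of the old
    pebbles, and the [R]-ball about its unit ball then reaches [3 * R + 3]. *)
Fixpoint ef_radius q := if q is q'.+1 then 3 * ef_radius q' + 3 else 0.

(* Every component [y] occurs in has isomorphic copies outside any list of
   fewer than [m] components. *)
Definition rich_over (J : Type) m F F' (comp : fworld F -> J)
    (comp' : fworld F' -> J) :=
  forall y (L : seq J), size L < m -> exists y' r,
    [/\ partial_iso r, r y y', ~ List.In (comp' y') L,
        forall x, comp x = comp y -> exists x', r x x' &
        forall x', comp' x' = comp' y' -> exists x, r x x'].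

(** The invariant with [q] rounds left: [r] covers the balls about the pebbled sets, and the list
    [L] of components in use leaves room for two more per round. *)
Definition ef_good (J : Type) m F F' (comp : fworld F -> J)
    (comp' : fworld F' -> J) q (r : fworld F -> fworld F' -> Prop) X X' :=
  [/\ partial_iso r, matched r X X',
      forall x, nbhd (ef_radius q) X x -> exists x', r x x',
      forall x', nbhd (ef_radius q) X' x' -> exists x, r x x' &
      exists L, [/\ size L + 2 * q <= m, forall x, X x -> List.In (comp x) L &
        forall x', X' x' -> List.In (comp' x') L]].

Lemma ef_good_flip (J : Type) m F F' (comp : fworld F -> J)
    (comp' : fworld F' -> J) q (r : fworld F -> fworld F' -> Prop) X X' :
  ef_good m comp comp' q r X X' ->
  ef_good m comp' comp q (fun x' x => r x x') X' X.
Proof.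
case=> pr mr dom ran [L [Lm XL XL']]; split=> //; first exact: partial_iso_flip.
  exact: matched_flip.
by exists L; split.
Qed.

Lemma ef_good_sub (J : Type) m F F' (comp : fworld F -> J)
    (comp' : fworld F' -> J) q r X X' Y Y' :
  ef_good m comp comp' q r X X' -> Y `<=` X -> Y' `<=` X' -> matched r Y Y' ->
  ef_good m comp comp' q r Y Y'.
Proof.
move=> [pr _ dom ran [L [Lm XL XL']]] YX YX' mY; split=> // [x|x'|].
- by move=> /(nbhd_mono YX)/dom.
- by move=> /(nbhd_mono YX')/ran.
by exists L; split=> // [x /YX/XL|x /YX'/XL'].
Qed.

Lemma matchedU (X Y : Type) (Z : X -> Y -> Prop) s t s' t' :
  matched Z s s' -> matched Z t t' -> matched Z (s `|` t) (s' `|` t').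
Proof.
move=> [ss' s's] [tt' t't]; split=> [x [/ss'|/tt']|y [/s's|/t't]] [z ? ?].
- by exists z => //; left.
- by exists z => //; right.
- by exists z => //; left.
- by exists z => //; right.
Qed.

Lemma adjacent_matched F F' (r : fworld F -> fworld F' -> Prop) k y y' :
  partial_iso r -> r y y' ->
  (forall x, nbhd k [set y] x -> exists x', r x x') ->
  forall x, nbhd k [set y] x -> exists2 x', nbhd k [set y'] x' & r x x'.
Proof.
move=> pr yy' dom x yx; have [x' xx'] := dom x yx; exists x' => //.
by apply: (partial_iso_nbhd pr dom _ xx' yx) => _ ->; exists y'.
Qed.

Section Extension.
Variables (J : Type) (m : nat) (F F' : frame N).
Variables (comp : fworld F -> J) (comp' : fworld F' -> J).
Hypothesis compP : forall x y, adjacent x y -> comp x = comp y.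
Hypothesis compP' : forall x y, adjacent x y -> comp' x = comp' y.
Hypothesis rich : rich_over m comp comp'.

(** A move close to the pebbles is answered by [r] itself, whose domain contains the whole smaller
    ball about the new point. *)
Lemma ef_extend_near q r (X : set (fworld F)) X' y :
  ef_good m comp comp' q.+1 r X X' ->
  nbhd (2 * ef_radius q).+2 X y ->
  exists2 y', r y y' &
    ef_good m comp comp' q r (X `|` nbhd 1 [set y]) (X' `|` nbhd 1 [set y']).
Proof.
set R := ef_radius q => -[pr mr dom ran [L [Lm XL XL']]] Xy.
have RE : ef_radius q.+1 = 3 * R + 3 by [].
have [y' yy'] : exists y', r y y'.
  by apply: dom; apply: nbhd_le Xy; lia.
have sub k : k <= (3 * R).+3 -> forall x, nbhd k X x -> exists x', r x x'.
  by move=> kR x Xx; apply: dom; apply: nbhd_le Xx; lia.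
have Xy' : nbhd (2 * R).+2 X' y'.
  by apply: (partial_iso_nbhd pr _ mr.1 yy' Xy); apply: sub; lia.
have ball (G : frame N) (Y : set (fworld G)) z : nbhd (2 * R).+2 Y z ->
    forall k, k <= R.+1 -> nbhd k [set z] `<=` nbhd (3 * R).+3 Y.
  move=> Yz k kR x zx; apply: (@nbhd_le _ _ _ _ (k + (2 * R).+2)); first by lia.
  by rewrite -nbhd_add; apply: nbhd_mono zx => _ ->.
have ball_union (G : frame N) (Y : set (fworld G)) z : nbhd (2 * R).+2 Y z ->
    nbhd R (Y `|` nbhd 1 [set z]) `<=` nbhd (ef_radius q.+1) Y.
  move=> Yz x; rewrite RE addnC nbhdU => -[|]; first by apply: nbhd_le; lia.
  by rewrite nbhd_add; apply: ball => //; lia.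
exists y' => //; split=> //.
- apply: matchedU mr _; split=> [x yx|x' yx'].
    apply: (adjacent_matched pr yy') yx => z /(ball _ _ _ Xy _ _) => /(_ isT).
    exact: sub.
  have pr' := partial_iso_flip pr.
  apply: (adjacent_matched pr' yy') yx' => z /(ball _ _ _ Xy' _ _) => /(_ isT) ?.
  by apply: ran; rewrite RE addnC.
- by move=> x /(ball_union _ _ _ Xy)/dom.
- by move=> x /(ball_union _ _ _ Xy')/ran.
exists L; split; first by lia.
  move=> x [/XL//|]; apply: (nbhd_component compP (L := fun j => List.In j L)) => _ ->.
  by apply: (nbhd_component compP (L := fun j => List.In j L)) XL _ Xy.
move=> x [/XL'//|]; apply: (nbhd_component compP' (L := fun j => List.In j L)) => _ ->.
by apply: (nbhd_component compP' (L := fun j => List.In j L)) XL' _ Xy'.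
Qed.

Lemma ef_extend_far q r (X : set (fworld F)) X' y :
  ef_good m comp comp' q.+1 r X X' ->
  ~ nbhd (2 * ef_radius q).+2 X y ->
  exists r' : fworld F -> fworld F' -> Prop, exists2 y', r' y y' &
    (forall x x', X x -> X' x' -> r x x' -> r' x x') /\
    ef_good m comp comp' q r' (X `|` nbhd 1 [set y]) (X' `|` nbhd 1 [set y']).
Proof.
set R := ef_radius q => -[pr mr dom ran [L [Lm XL XL']]] Xy.
have RE : ef_radius q.+1 = 3 * R + 3 by [].
have [|y' [s [ps yy' y'L doms rans]]] := rich y (L := L); first by lia.
(* The radii [R] and [R.+1] differ because the pebbled set gains the unit ball of [y], whose
   [R]-ball must be covered. *)
pose near x x' := [/\ r x x', nbhd R X x & nbhd R X' x'].
pose far x x' := [/\ s x x', nbhd R.+1 [set y] x & nbhd R.+1 [set y'] x'].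
have comp_y k x : nbhd k [set y] x -> comp x = comp y.
  by apply: (nbhd_component compP (L := [set comp y])) => _ ->.
have comp_y' k x' : nbhd k [set y'] x' -> comp' x' = comp' y'.
  by apply: (nbhd_component compP' (L := [set comp' y'])) => _ ->.
have nadj x z : nbhd R X x -> nbhd R.+1 [set y] z -> ~ adjacent x z.
  by apply: nbhd_far; have -> : (R + R.+1).+1 = (2 * R).+2 by lia.
have nadj' x z : nbhd R X' x -> nbhd R.+1 [set y'] z -> ~ adjacent x z.
  move=> X'x /comp_y' zy' /compP' xz; apply: y'L; rewrite -zy' -xz.
  by apply: (nbhd_component compP' (L := fun j => List.In j L)) XL' _ X'x.
have domr x : nbhd R X x -> exists2 x', nbhd R X' x' & r x x'.
  move=> Xx; have [|x' xx'] := dom x; first by apply: nbhd_le Xx; lia.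
  exists x' => //; apply: (partial_iso_nbhd pr _ mr.1 xx' Xx) => z Xz.
  by apply: dom; apply: nbhd_le Xz; lia.
have ranr x' : nbhd R X' x' -> exists2 x, nbhd R X x & r x x'.
  move=> Xx'; have [|x xx'] := ran x'; first by apply: nbhd_le Xx'; lia.
  exists x => //; apply: (partial_iso_nbhd (partial_iso_flip pr) _ mr.2 xx' Xx') => z Xz.
  by apply: ran; apply: nbhd_le Xz; lia.
have domf k x : nbhd k [set y] x -> exists2 x', nbhd k [set y'] x' & s x x'.
  by apply: (adjacent_matched ps yy') => z /comp_y/doms.
have ranf k x' : nbhd k [set y'] x' -> exists2 x, nbhd k [set y] x & s x x'.
  by apply: (adjacent_matched (partial_iso_flip ps) yy') => z /comp_y'/rans.
have y_near : nbhd 1 [set y] `<=` nbhd R.+1 [set y] by apply: nbhd_le.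
have y'_near : nbhd 1 [set y'] `<=` nbhd R.+1 [set y'] by apply: nbhd_le.
have refl_nbhd (G : frame N) (Y : set (fworld G)) k : Y `<=` nbhd k Y.
  by apply: (@nbhd_le _ _ _ _ 0).
exists (fun x x' => near x x' \/ far x x'), y'.
  by right; split=> //; apply: refl_nbhd.
split; first by move=> x x' Xx X'x' xx'; left; split=> //; apply: refl_nbhd.
split.
- case: pr ps => [rpi rs re rc] [spi ss se sc]; split.
  + by move=> x x' [[/rpi]|[/spi]].
  + by move=> a x x' [[/rs]|[/ss]].
  + move=> x x' z z' [[xx' Xx X'x']|[xx' yx yx']] [[zz' Xz X'z']|[zz' yz yz']].
    * exact: re xx' zz'.
    * split=> e; first by case: (nadj _ _ Xx yz); rewrite e; apply: adjacent_refl.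
      by case: (nadj' _ _ X'x' yz'); rewrite e; apply: adjacent_refl.
    * split=> e; first by case: (nadj _ _ Xz yx); rewrite e; apply: adjacent_refl.
      by case: (nadj' _ _ X'z' yx'); rewrite e; apply: adjacent_refl.
    * exact: se xx' zz'.
  + move=> g x x' z z' [[xx' Xx X'x']|[xx' yx yx']] [[zz' Xz X'z']|[zz' yz yz']].
    * exact: rc xx' zz'.
    * split=> e; first by case: (nadj _ _ Xx yz); exists g.
      by case: (nadj' _ _ X'x' yz'); exists g.
    * split=> e; first by case: (nadj _ _ Xz yx); exists g.
      by case: (nadj' _ _ X'z' yx'); exists g.
    * exact: sc xx' zz'.
- split=> [x [Xx|yx]|x' [Xx'|yx']].
  + have [x' X'x' xx'] := mr.1 x Xx; exists x'; first by left.
    by left; split=> //; apply: refl_nbhd.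
  + have [x' yx' xx'] := domf _ _ yx; exists x'; first by right.
    by right; split=> //; [apply: y_near|apply: y'_near].
  + have [x X'x xx'] := mr.2 x' Xx'; exists x; first by left.
    by left; split=> //; apply: refl_nbhd.
  + have [x yx xx'] := ranf _ _ yx'; exists x; first by right.
    by right; split=> //; [apply: y_near|apply: y'_near].
- move=> x; rewrite nbhdU nbhd_add addn1 => -[Xx|yx].
    by have [x' ? ?] := domr x Xx; exists x'; left.
  by have [x' ? ?] := domf _ _ yx; exists x'; right.
- move=> x'; rewrite nbhdU nbhd_add addn1 => -[Xx'|yx'].
    by have [x ? ?] := ranr x' Xx'; exists x; left.
  by have [x ? ?] := ranf _ _ yx'; exists x; right.
(* One component is used up on each side, which accounts for the [2 * q] in [ef_good]. *)
exists [:: comp y, comp' y' & L]; split=> /=; first by lia.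
  by move=> x [/XL|/(comp_y 1) ->]; [right; right|left].
by move=> x [/XL'|/(comp_y' 1) ->]; [right; right|right; left].
Qed.

(** Adding the unit ball of [y] rather than [y] alone makes one extension step serve moves of both
    sorts. *)
Lemma ef_extend q r (X : set (fworld F)) X' y :
  ef_good m comp comp' q.+1 r X X' ->
  exists r' : fworld F -> fworld F' -> Prop, exists2 y', r' y y' &
    (forall x x', X x -> X' x' -> r x x' -> r' x x') /\
    ef_good m comp comp' q r' (X `|` nbhd 1 [set y]) (X' `|` nbhd 1 [set y']).
Proof.
move=> g; have [Xy|Xy] := pselect (nbhd (2 * ef_radius q).+2 X y).
  by have [y' ? ?] := ef_extend_near g Xy; exists r, y'.
exact: ef_extend_far g Xy.
Qed.

End Extension.
End PartialIsomorphisms.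

(** * The Ehrenfeucht-Fraïssé game on the models of frames *)

Section Positions.
Variables (Ag At : Type) (N : relmodel Ag At) (J : Type) (b : nat).
Implicit Types F : frame N.

Definition ef_context F F' (comp : fworld F -> J) (comp' : fworld F' -> J) :=
  [/\ forall x y, adjacent x y -> comp x = comp y,
      forall x y, adjacent x y -> comp' x = comp' y,
      rich_over b comp comp' & rich_over b comp' comp].

Definition pebbled F m n (u : m.-tuple (fworld F))
    (v : n.-tuple (state (fmodel F))) : set (fworld F) :=
  [set x | (exists i, tnth u i = x) \/ exists j, worlds_of (tnth v j) x].

Definition ef_position F F' (comp : fworld F -> J) (comp' : fworld F' -> J) q
    m n (u : m.-tuple (fworld F)) (v : n.-tuple (state (fmodel F)))
    (u' : m.-tuple (fworld F')) (v' : n.-tuple (state (fmodel F'))) :=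
  exists r, [/\ ef_good b comp comp' q r (pebbled u v) (pebbled u' v'),
    forall i, r (tnth u i) (tnth u' i) &
    forall j, matched r (worlds_of (tnth v j)) (worlds_of (tnth v' j))].

Lemma ef_position_flip F F' (comp : fworld F -> J) (comp' : fworld F' -> J) q
    m n (u : m.-tuple (fworld F)) (v : n.-tuple (state (fmodel F)))
    (u' : m.-tuple (fworld F')) (v' : n.-tuple (state (fmodel F'))) :
  ef_position comp comp' q u v u' v' -> ef_position comp' comp q u' v' u v.
Proof.
move=> [r [g uu' vv']]; exists (fun x' x => r x x'); split=> // [|j].
  exact: ef_good_flip.
exact: matched_flip.
Qed.

Lemma pebbled_consW F m n (u : m.-tuple (fworld F))
    (v : n.-tuple (state (fmodel F))) y :
  pebbled [tuple of y :: u] v = pebbled u v `|` [set y].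
Proof.
apply/seteqP; split=> x.
  move=> [[i]|vx]; last by left; right.
  case: (unliftP ord0 i) => [k ->|->]; rewrite ?tnthS ?tnth0 => <-; last by right.
  by left; left; exists k.
move=> [[[i <-]|?]| ->]; last by left; exists ord0; rewrite tnth0.
  by left; exists (lift ord0 i); rewrite tnthS.
by right.
Qed.

Lemma pebbled_consS F m n (u : m.-tuple (fworld F))
    (v : n.-tuple (state (fmodel F))) t :
  pebbled u [tuple of t :: v] = pebbled u v `|` worlds_of t.
Proof.
apply/seteqP; split=> x.
  move=> [ux|[i]]; first by left; left.
  case: (unliftP ord0 i) => [k ->|->]; rewrite ?tnthS ?tnth0 => ?; last by right.
  by left; right; exists k.
move=> [[?|[i ?]]|?]; first by left.
  by right; exists (lift ord0 i); rewrite tnthS.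
by right; exists ord0; rewrite tnth0.
Qed.

Lemma matched_weaken (X Y : Type) (Z Z' : X -> Y -> Prop) s t :
  (forall x y, s x -> t y -> Z x y -> Z' x y) -> matched Z s t -> matched Z' s t.
Proof.
move=> ZZ' [st ts]; split=> [x sx|y ty].
  by have [y ty Zxy] := st x sx; exists y => //; apply: ZZ'.
by have [x sx Zxy] := ts y ty; exists x => //; apply: ZZ'.
Qed.

Section Moves.
Variables (F F' : frame N) (comp : fworld F -> J) (comp' : fworld F' -> J).
Hypothesis ctx : ef_context comp comp'.
Variables (q m n : nat).
Variables (u : m.-tuple (fworld F)) (v : n.-tuple (state (fmodel F))).
Variables (u' : m.-tuple (fworld F')) (v' : n.-tuple (state (fmodel F'))).
Hypothesis pos : ef_position comp comp' q.+1 u v u' v'.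

Lemma ef_moveW y : exists y',
  ef_position comp comp' q [tuple of y :: u] v [tuple of y' :: u'] v'.
Proof.
have [r [g uu' vv']] := pos; have [cP cP' rich _] := ctx.
have [r' [y' yy' [rr' g']]] := ef_extend cP cP' rich y g.
have [_ mr _ _ _] := g.
exists y', r'; split=> [|i|j].
- rewrite !pebbled_consW; apply: ef_good_sub g' _ _ _.
  + by apply: setUS => _ ->; exists y => //; apply: adjacent_refl.
  + by apply: setUS => _ ->; exists y' => //; apply: adjacent_refl.
  + by apply: matchedU (matched_weaken rr' mr) _; split=> _ ->; [exists y'|exists y].
- case: (unliftP ord0 i) => [k ->|->]; rewrite ?tnthS ?tnth0 //.
  by apply: rr' => //; left; exists k.
- by apply: matched_weaken (vv' j) => x x' vx vx'; apply: rr'; right; exists j.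
Qed.

Lemma ef_moveS (t : state (fmodel F)) : exists t' : state (fmodel F'),
  ef_position comp comp' q u [tuple of t :: v] u' [tuple of t' :: v'].
Proof.
have [r [g uu' vv']] := pos; have [cP cP' rich _] := ctx.
have [a [y ty]] := svalP t.
have [r' [y' yy' [rr' g']]] := ef_extend cP cP' rich y g.
have [_ mr _ _ _] := g; have [pr' _ dom' _ _] := g'.
have ty1 : worlds_of t `<=` nbhd 1 [set y].
  by move=> x /ty e; exists y => //; exists a.
(* II answers with the image of [t]; it is a state because [r'] preserves the class containing
   [t]. *)
pose t0 := [set x' | exists2 x, worlds_of t x & r' x x'].
have t0y x' : t0 x' -> fclass a x' = fclass a y'.
  move=> [x /ty e xx']; have [_ _ _ rc] := pr'.
  by apply/(rc a _ _ _ _ xx' yy').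
have t0y1 : t0 `<=` nbhd 1 [set y'].
  by move=> x' /t0y e; exists y' => //; exists a.
have mt : matched r' (worlds_of t) t0.
  split=> // x tx; have [x' xx'] : exists x', r' x x'.
    by apply: dom'; apply: (@nbhd_le _ _ _ _ 0) => //; right; apply: ty1.
  by exists x' => //; exists x.
have [t' t'E] : exists t' : state (fmodel F'), worlds_of t' = t0.
  by apply: fmodel_state; exists a, y'.
exists t', r'; split=> [|i|j].
- rewrite !pebbled_consS t'E; apply: ef_good_sub g' _ _ _; try exact: setUS.
  by apply: matchedU (matched_weaken rr' mr) _.
- by apply: rr' => //; left; exists i.
- case: (unliftP ord0 j) => [k ->|->]; rewrite ?tnthS ?tnth0 ?t'E //.
  by apply: matched_weaken (vv' k) => x x' vx vx'; apply: rr'; right; exists k.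
Qed.

End Moves.

Fixpoint quantifier_rank m n (f : fo Ag At m n) : nat :=
  match f with
  | FImp f g => maxn (quantifier_rank f) (quantifier_rank g)
  | FAllW f => (quantifier_rank f).+1
  | FAllS f => (quantifier_rank f).+1
  | _ => 0
  end.

Lemma matched_fpi F F' r (t : set (fworld F)) (t' : set (fworld F')) :
  partial_iso r -> matched r t t' -> [set fpi x | x in t] = [set fpi x | x in t'].
Proof.
move=> [rpi _ _ _] [tt' t't]; apply/seteqP; split=> _ [x tx <-].
  by have [x' ? /rpi ->] := tt' x tx; exists x'.
by have [x' ? /rpi <-] := t't x tx; exists x'.
Qed.

Lemma matched_fSigma F F' r a z z' (t : set (fworld F)) (t' : set (fworld F')) :
  partial_iso r -> matched r t t' -> r z z' -> fSigma a z t -> fSigma a z' t'.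
Proof.
move=> pr mt zz' [cl sd St]; have [rpi rs re rc] := pr.
split=> [y' /mt.2[y ty yy']|y1' y2' /mt.2[y1 t1 r1] /mt.2[y2 t2 r2]|].
- by apply/(rc _ _ _ _ _ yy' zz'); apply: cl.
- by rewrite -(rs _ _ _ r1) -(rs _ _ _ r2); apply: sd.
- by rewrite -(matched_fpi pr mt) -(rpi _ _ zz').
Qed.

Lemma partial_iso_mem F F' r x x' (t : set (fworld F)) (t' : set (fworld F')) :
  partial_iso r -> matched r t t' -> r x x' -> t x -> t' x'.
Proof.
move=> [_ _ re _] mt xx' /mt.1[y' ty' xy'].
by have [/(_ erefl) -> _] := re _ _ _ _ xx' xy'.
Qed.

Lemma partial_iso_set_eq F F' r (s t : set (fworld F)) (s' t' : set (fworld F')) :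
  partial_iso r -> matched r s s' -> matched r t t' -> s = t -> s' = t'.
Proof.
move=> pr ms mt st; apply/seteqP; split=> x'.
  by move=> /ms.2[x + xx']; rewrite st; apply: partial_iso_mem pr mt xx'.
by move=> /mt.2[x + xx']; rewrite -st; apply: partial_iso_mem pr ms xx'.
Qed.

(** One implication suffices, as positions are symmetric: antecedents use the flipped position, and
    a quantifier over [F'] is met by moving there and answering in [F]. *)
Lemma ef_sat m n (f : fo Ag At m n) :
  forall F F' (comp : fworld F -> J) (comp' : fworld F' -> J),
  ef_context comp comp' -> forall q u v u' v', quantifier_rank f <= q ->
  ef_position comp comp' q u v u' v' ->
  @sat _ _ (fmodel F) _ _ f u v -> @sat _ _ (fmodel F') _ _ f u' v'.
Proof.
elim: f => {m n} [m n a x y|m n x y|m n i x|m n x y|m n x y|m n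
  |m n f IHf g IHg|m n f IH|m n f IH] F F' comp comp' ctx q u v u' v' /= fq pos.
- have [r [[pr _ _ _ _] uu' vv']] := pos.
  exact: matched_fSigma pr (vv' y) (uu' x).
- have [r [[pr _ _ _ _] uu' vv']] := pos.
  exact: partial_iso_mem pr (vv' y) (uu' x).
- have [r [[[rpi _ _ _] _ _ _ _] uu' vv']] := pos.
  by move=> /= ux; rewrite /mkset -(rpi _ _ (uu' x)).
- have [r [[[_ _ re _] _ _ _ _] uu' vv']] := pos.
  by move/(re _ _ _ _ (uu' x) (uu' y)).
- have [r [[pr _ _ _ _] uu' vv']] := pos.
  move=> vxy; apply: fstate_ext.
  apply: (partial_iso_set_eq pr (vv' x) (vv' y)).
  by rewrite vxy.
- by [].
- have [gq hq] : quantifier_rank f <= q /\ quantifier_rank g <= q by lia.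
  have ctx' : ef_context comp' comp by case: ctx.
  move=> fg /(IHf _ _ _ _ ctx' _ _ _ _ _ gq (ef_position_flip pos))/fg.
  exact: (IHg _ _ _ _ ctx _ _ _ _ _ hq pos).
- have ctx' : ef_context comp' comp by case: ctx.
  case: q fq pos => // q fq /ef_position_flip pos h w'.
  have [w /ef_position_flip pos'] := ef_moveW ctx' pos w'.
  exact: (IH _ _ _ _ ctx _ _ _ _ _ fq pos' (h w)).
- have ctx' : ef_context comp' comp by case: ctx.
  case: q fq pos => // q fq /ef_position_flip pos h w'.
  have [w /ef_position_flip pos'] := ef_moveS ctx' pos w'.
  exact: (IH _ _ _ _ ctx _ _ _ _ _ fq pos' (h w)).
Qed.

End Positions.

(** * Partial unravellings *)

Section Unravelling.
Variables (Ag At : Type) (N : relmodel Ag At).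
Hypothesis Ne : epistemic N.
Variables (S0 : set (world N)) (act : set Ag) (l b : nat).
Hypothesis S0_neq0 : S0 !=set0.

Definition walk : Type := seq (Ag * world N).

Definition headed (a : Ag) (p : walk) : Prop :=
  if p is (c, _) :: _ then c = a else False.

Definition endpoint (p : walk) (u0 : world N) : world N :=
  if p is (_, u) :: _ then u else u0.

(* Walks from [u0] are written backwards, the last step first. *)
Fixpoint valid_walk (u0 : world N) (p : walk) : Prop :=
  if p is (a, u) :: q then
    [/\ valid_walk u0 q, act a, accessible a (endpoint q u0) u & ~ headed a q]
  else S0 u0.

Definition is_point (z : walk * world N + world N) : Prop :=
  if z is inl (p, u0) then valid_walk u0 p /\ size p <= l else True.

Definition point := {z | is_point z}.

Definition component : eqType := option ('I_b * bool).

Definition point_pi (z : walk * world N + world N) : world N :=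
  match z with inl (p, u0) => endpoint p u0 | inr u => u end.

Definition point_side (a : Ag) (z : walk * world N + world N) : bool :=
  if z is inl (p, _) then `[< headed a p >] else false.

(** Consecutive steps of a valid walk carry different agents, so its base never ends in a step by
    [a] and can label the class formed by itself and its extensions by [a]. *)
Definition base (a : Ag) (p : walk) : walk :=
  if `[< headed a p >] then behead p else p.

(* Every walk and its one-step extensions by [a] form a class of agent [a]. If
   [glued], the walks of maximal length [l] moreover join the classes of their
   end points in a copy of [N], so that the result is bisimilar to [N];
   otherwise the tree of walks is disconnected from [N]. All roots form a class
   of the extra index [None]. The walk and its extensions are on different sides
   of the class: the walk has more depth left below it than its extensions, and
   a state mixing both would have no counterpart in the truncation of a model
   that is only equivalent up to finite depth. *)
Definition point_class (glued : bool) (g : option Ag)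
    (z : walk * world N + world N) : walk * world N + set (world N) :=
  match g, z with
  | Some a, inl (p, u0) =>
      if ~~ `[< headed a p >] && glued && (size p == l)
      then inr (accessible a (endpoint p u0)) else inl (base a p, u0)
  | Some a, inr u => inr (accessible a u)
  | None, inl (p, u0) => if p is [::] then inr set0 else inl (p, u0)
  | None, inr u => inr [set u]
  end.

(* Component [None] carries the roots; [c] tells whether it is glued. All other
   components are the same for both values of [c]. *)
Definition glue (c : bool) (j : component) : bool :=
  if j is Some (_, d) then d else c.

Lemma accessible_base a (p : walk) u0 : valid_walk u0 p ->
  accessible a (endpoint (base a p) u0) (endpoint p u0).
Proof.
rewrite /base; case: asboolP => [|_ _]; last exact: accessible_refl.
by case: p => // -[a' u] q /= -> [].
Qed.

Lemma point_class_rep glued a z : is_point z ->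
  match point_class glued (Some a) z with
  | inl (q, u0) => accessible a (endpoint q u0) (point_pi z)
  | inr X => X = accessible a (point_pi z)
  end.
Proof.
case: z => [[p u0] [vp _]|u _] //=; case: ifP => // _.
exact: accessible_base.
Qed.

Lemma point_class_accessible glued a z z' : is_point z -> is_point z' ->
  point_class glued (Some a) z = point_class glued (Some a) z' ->
  accessible a (point_pi z) (point_pi z').
Proof.
move=> /(point_class_rep glued a) h /(point_class_rep glued a) h' e.
move: h h'; rewrite -e; case: (point_class _ _ _) => [[q u0] h|X ->] h'.
  by apply: accessible_trans h'; [|apply: accessible_sym].
by rewrite h'; apply: accessible_refl.
Qed.

Lemma unravelling_inh : inhabited (component * point).
Proof.
have [u0 Su0] := S0_neq0; constructor; split; first exact: None.
by exists (inl ([::], u0)).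
Qed.

Lemma unravelling_accessible c a (z z' : component * point) :
  (z.1, point_class (glue c z.1) (Some a) (sval z.2)) =
  (z'.1, point_class (glue c z'.1) (Some a) (sval z'.2)) ->
  accessible a (point_pi (sval z.2)) (point_pi (sval z'.2)).
Proof.
case=> -> /point_class_accessible; apply; exact: svalP.
Qed.

Definition unravelling (c : bool) : frame N :=
  @Frame _ _ N _ unravelling_inh _
    (fun g z => (z.1, point_class (glue c z.1) g (sval z.2)))
    (fun a z => point_side a (sval z.2)) (fun z => point_pi (sval z.2))
    (@unravelling_accessible c).

Lemma unravelling_adjacent c (x y : fworld (unravelling c)) :
  adjacent x y -> x.1 = y.1.
Proof. by move=> [g /= []]. Qed.

(** Pigeonhole: there are [b] components of each kind. *)
Lemma fresh_component (d : bool) (L : seq component) : size L < b ->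
  exists i : 'I_b, ~ List.In (Some (i, d) : component) L.
Proof.
move=> Lb; apply: contrapT => /forallNP h.
have mem_In (x : component) : List.In x L -> x \in L.
  elim: L {Lb h} => //= y L IH [->|/IH xL]; first exact: mem_head.
  by rewrite inE xL orbT.
pose f (i : 'I_b) : component := Some (i, d).
have : size (map f (enum 'I_b)) <= size L.
  apply: uniq_leq_size; first by rewrite map_inj_uniq ?enum_uniq // => i j [].
  by move=> _ /mapP[i _ ->]; apply: mem_In; apply: contrapT; apply: h.
by rewrite size_map size_enum_ord leqNgt Lb.
Qed.

(** Components that agree on being glued are isomorphic by the identity on points. *)
Lemma unravelling_rich c c' : @rich_over _ _ N component b
  (unravelling c) (unravelling c') (fun x => x.1) (fun x => x.1).
Proof.
move=> [j z] L /(fresh_component (glue c j))[i iL].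
pose j' : component := Some (i, glue c j).
exists (j', z), (fun x x' => [/\ x.1 = j, x'.1 = j' & x.2 = x'.2]).
split=> //=.
- split.
  + by move=> [? x] [? x'] /= [_ _ ->].
  + by move=> a [? x] [? x'] /= [_ _ ->].
  + by move=> [? x] [? x'] [? y] [? y'] /= [-> -> ->] [-> -> ->]; split=> -[->].
  + by move=> g [? x] [? x'] [? y] [? y'] /= [-> -> ->] [-> -> ->]; split=> -[->].
- by move=> [? x] /= ->; exists (j', x).
- by move=> [? x] /= ->; exists (j, x).
Qed.

Lemma unravelling_context c c' : @ef_context _ _ N component b
  (unravelling c) (unravelling c') (fun x => x.1) (fun x => x.1).
Proof.
by split; try exact: unravelling_rich; apply: unravelling_adjacent.
Qed.

Definition root_of (u0 : world N) (x : component * point) : Prop :=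
  x.1 = None /\ sval x.2 = inl ([::], u0).

Definition roots : set (component * point) := [set x | exists u0, root_of u0 x].

Definition short (k : nat) (x : component * point) : Prop :=
  x.1 = None /\ exists p u0, sval x.2 = inl (p, u0) /\ size p <= k.

(** Gluing only affects the labels of walks of length exactly [l]. *)
Lemma point_class_short c c' g x k : k < l -> short k x ->
  point_class c g (sval x.2) = point_class c' g (sval x.2).
Proof.
move=> kl [_ [p [u0 [-> pk]]]]; case: g => //= a.
have -> : (size p == l) = false by lia.
by rewrite !andbF.
Qed.

(** Adjacency changes the length of a walk by at most one, and the copy of [N] is attached only at
    length [l]. *)
Lemma nbhd_short c k (X : set (fworld (unravelling c))) x : k < l ->
  X `<=` roots -> nbhd k X x -> short k x.
Proof.
move=> + Xr; elim: k x => [|k IH] x kl.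
  by move=> /Xr[u0 [x1 x2]]; split=> //; exists [::], u0.
move=> [y /IH - /(_ (ltnW kl)) [y1 [p [u0 [y2 pk]]]] [g]] [/= e1 e2].
split; first by rewrite -e1.
move: e2; rewrite y2 /=.
have pl : (size p == l) = false by lia.
case: (sval x.2) => [[p' u0']|u] /=; case: g => [a|] /=.
- rewrite pl !andbF; case: ifP => // _ [+ _].
  rewrite /base; case: ifP => _; case: ifP => _ eq; exists p', u0'; split=> //.
  + by move: (congr1 size eq); rewrite !size_behead; lia.
  + by move: (congr1 size eq); rewrite !size_behead; lia.
  + by move: (congr1 size eq); rewrite !size_behead; lia.
  + by rewrite -eq; lia.
- case: p pk pl {y2} => [|s p] pk pl; case: p' => [|s' p'] //.
    by move=> _; exists [::], u0'.
  by move=> [<- <- <-]; exists (s :: p), u0; split=> //; apply: leqW.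
- by rewrite pl !andbF.
(* For the index [None], roots are labelled by [set0] and worlds of [N] by singletons, so the two
   never meet. *)
- by case: p pk pl {y2} => // _ _ [/seteqP[_ /(_ u erefl)]].
Qed.

(** The identity on short walks is the initial isomorphism. All pebbles sit in component [None], so
    [L] has one element and [2 * q < b] leaves enough room. *)
Lemma unravelling_good q (X : set (component * point)) :
  ef_radius q < l -> 2 * q < b -> X `<=` roots ->
  @ef_good _ _ N component b (unravelling true) (unravelling false)
    (fun x => x.1) (fun x => x.1) q
    (fun x x' => x = x' /\ short (ef_radius q) x) X X.
Proof.
move=> ql qb Xr.
have Xs x : X x -> short (ef_radius q) x.
  by move=> /Xr[u0 [x1 x2]]; split=> //; exists [::], u0.
split.
- split=> [x _ [<- _]//|a x _ [<- _]//|x _ y _ [<- _] [<- _]//|].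
  move=> g x _ y _ [<- sx] [<- sy] /=.
  by rewrite (point_class_short _ true g ql sx) (point_class_short _ true g ql sy)
    (point_class_short (glue false x.1) true g ql sx)
    (point_class_short (glue false y.1) true g ql sy).
- by split=> x Xx; exists x => //; split=> //; apply: Xs.
- by move=> x /(nbhd_short ql Xr); exists x.
- by move=> x /(nbhd_short ql Xr); exists x.
exists [:: None]; split=> //=.
  by move=> x /Xr[u0 [-> _]]; left.
by move=> x /Xr[u0 [-> _]]; left.
Qed.

End Unravelling.

(** * Glued unravellings are bisimilar to the model *)

Section UnravellingBisimulation.
Variables (Ag At : Type) (N : relmodel Ag At).
Hypothesis Ne : epistemic N.
Variables (S0 : set (world N)) (act : set Ag) (l b : nat).
Hypothesis S0_neq0 : S0 !=set0.
Hypothesis inactive_trivial : forall a, ~ act a ->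
  forall w v : world N, accessible a w v -> w = v.

Let U := unravelling Ne act l b S0_neq0 true.

(* [s] is lifted to extensions of a common walk, or, at a leaf, to the glued copy
   of [N]; a set of an inactive agent has at most one element. *)
Lemma unravelling_lift (z : fworld U) a (s : set (world N)) :
  glue true z.1 -> star_Sigma a (fpi z) s ->
  exists2 t, fSigma a z t & [set fpi y | y in t] = s.
Proof.
case: z => j [z pz] /= gj Ss.
have := point_class_rep Ne true a pz.
case zE : (point_class l true (Some a) z) => [[q u0]|X] rep.
  (* A leaf not headed by [a] has joined the copy of [N], so here the common walk is shorter than
     [l] and can be extended. *)
  have [vq qh ql] : [/\ valid_walk S0 act u0 q, ~ headed a q & size q < l].
    case: z zE pz {rep Ss} => [[p u1]|u] //=; case: ifP => // /negbT.
    rewrite /base; case: asboolP => hp /= np [<- <-] [vp pl]; last first.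
      by split=> //; rewrite ltn_neqAle np.
    by case: p hp vp pl {np} => // -[c u] q' /= -> [vq' _ _ nh] ql'.
  have qs := accessible_star Ne rep.
  have [aa|na] := pselect (act a).
    pose t : set (fworld U) :=
      [set y | y.1 = j /\ exists2 u, s u & sval y.2 = inl ((a, u) :: q, u0)].
    have tE y : t y -> point_class l true (Some a) (sval y.2) = inl (q, u0)
        /\ point_side a (sval y.2).
      by move=> [_ [u _ ->]] /=; rewrite /base /=; rewrite asboolT.
    have imt : [set fpi y | y in t] = s.
      apply/seteqP; split=> [_ [y [_ [u su yu]] <-]|u su] /=; first by rewrite yu.
      have pu : is_point S0 act l (inl ((a, u) :: q, u0)).
        split=> //=; split=> //; apply: star_Sigma_accessible su.
        by rewrite qs.
      by exists (j, exist _ _ pu) => //; split=> //; exists u.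
    exists t => //; split=> [y ty|y y' /tE[_ ys] /tE[_ ys']|].
    - have [yc _] := tE y ty; have [yj _] := ty.
      rewrite -[LHS]/(y.1, point_class l (glue true y.1) (Some a) (sval y.2)).
      rewrite -[RHS]/(j, point_class l (glue true j) (Some a) z).
      by rewrite yj gj yc zE.
    - by rewrite /= ys ys'.
    - by rewrite imt.
  exists [set y | y = (j, exist _ z pz) /\ s (point_pi z)].
    split=> [y [-> _]//|y y' [-> _] [-> _]//|].
    apply: star_Sigma_down Ss _ => _ [y [-> su] <-] //.
  apply/seteqP; split=> [_ [y [-> su] <-]//|u su].
  have e : point_pi z = u by apply: inactive_trivial na _ _ (star_Sigma_accessible Ss su).
  by exists (j, exist _ z pz) => //=; split=> //; rewrite e.
pose t : set (fworld U) := [set y | y.1 = j /\ exists2 u, s u & sval y.2 = inr u].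
have imt : [set fpi y | y in t] = s.
  apply/seteqP; split=> [_ [y [_ [u su yu]] <-]|u su] /=; first by rewrite yu.
  by exists (j, exist (is_point S0 act l) (inr u) I) => //; split=> //; exists u.
exists t => //; split=> [[j' y] [/= -> [u su ->]]|y y' [_ [u _ yu]] [_ [u' _ yu']]|].
- rewrite -[RHS]/(j, point_class l (glue true j) (Some a) z) gj zE rep /=.
  congr (_, inr _); apply/esym/accessible_eq => //.
  exact: star_Sigma_accessible Ss su.
- by rewrite /= yu yu'.
- by rewrite imt.
Qed.

(** Forth is immediate, as [fSigma] refers to the image in [N]; back is [unravelling_lift]. *)
Lemma unravelling_projection : @bisimulation _ _ (star (fmodel U)) (star N)
  (fun z w => glue true z.1 /\ fpi z = w).
Proof.
move=> z _ [gz <-].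
have m a t : fSigma a z t -> matched (fun (z : fworld U) w => glue true z.1 /\ fpi z = w)
    t [set fpi y | y in t].
  move=> [tz _ _]; have gt y : t y -> glue true y.1.
    by move=> /tz /(congr1 fst) /= ->.
  split=> [y ty|_ [y ty <-]]; last by exists y => //; split=> //; apply: gt.
  by exists (fpi y); [exists y|split=> //; apply: gt].
split=> // a s; last first.
  move=> Ss; have [t St <-] := unravelling_lift gz Ss.
  by exists t; [apply/star_fmodel|apply: m St].
by move=> /star_fmodel St; exists [set fpi y | y in s]; [case: St|apply: m St].
Qed.

Lemma wbisim_unravelling (z : fworld U) :
  glue true z.1 -> @wbisim _ _ (fmodel U) N z (fpi z).
Proof.
by move=> gz; apply: (bisimulation_II_wins unravelling_projection).
Qed.

End UnravellingBisimulation.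

(** * Truncated unravellings are determined by finite types *)

Section TruncatedBisimulation.
Variables (Ag At : Type) (n m : nat) (act : 'I_n -> Ag) (at_ : 'I_m -> At).
Variables (l b : nat).

(** Worlds reached after [i] steps share their type of depth [l.+1 - i]; leaves retain depth [1],
    which still decides the atoms. *)
Fixpoint walk_rel (N N' : relmodel Ag At) (p : walk N) (u0 : world N)
    (p' : walk N') (u0' : world N') : Prop :=
  match p, p' with
  | [::], [::] => mcolour act at_ l.+1 u0 = mcolour act at_ l.+1 u0'
  | (a, u) :: q, (a', u') :: q' =>
      [/\ a = a', walk_rel q u0 q' u0' &
          mcolour act at_ (l - size q) u = mcolour act at_ (l - size q) u']
  | _, _ => False
  end.

Lemma walk_rel_size (N N' : relmodel Ag At) (p : walk N) u0 (p' : walk N') u0' :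
  walk_rel p u0 p' u0' -> size p = size p'.
Proof.
by elim: p p' => [|[a u] q IH] [|[a' u'] q'] //= [_ /IH ->].
Qed.

Lemma walk_rel_sym (N N' : relmodel Ag At) (p : walk N) u0 (p' : walk N') u0' :
  walk_rel p u0 p' u0' -> walk_rel p' u0' p u0.
Proof.
elim: p p' => [|[a u] q IH] [|[a' u'] q'] //= [-> h e]; split=> //; first exact: IH.
by rewrite -(walk_rel_size h).
Qed.

Lemma walk_rel_headed (N N' : relmodel Ag At) (p : walk N) u0 (p' : walk N') u0' a :
  walk_rel p u0 p' u0' -> headed a p <-> headed a p'.
Proof. by case: p p' => [|[c u] q] [|[c' u'] q'] //= [-> _ _]. Qed.

Lemma walk_rel_base (N N' : relmodel Ag At) (p : walk N) u0 (p' : walk N') u0' a :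
  walk_rel p u0 p' u0' -> walk_rel (base a p) u0 (base a p') u0'.
Proof.
move=> h; rewrite /base (asbool_equiv_eq (walk_rel_headed a h)).
case: ifP => // _.
by case: p p' h => [|[c u] q] [|[c' u'] q'] //= [_ ? _].
Qed.

Lemma walk_rel_colour (N N' : relmodel Ag At) (p : walk N) u0 (p' : walk N') u0' :
  walk_rel p u0 p' u0' ->
  mcolour act at_ (l.+1 - size p) (endpoint p u0) =
  mcolour act at_ (l.+1 - size p) (endpoint p' u0').
Proof.
by case: p p' => [|[a u] q] [|[a' u'] q'] //= [_ _ e]; rewrite subSS.
Qed.

Definition point_rel (N N' : relmodel Ag At) S0 S0'
    (x : component b * point (N := N) S0 (range act) l)
    (x' : component b * point (N := N') S0' (range act) l) : Prop :=
  [/\ x.1 = None, x'.1 = None &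
    match sval x.2, sval x'.2 with
    | inl (p, u0), inl (p', u0') => walk_rel p u0 p' u0'
    | _, _ => False
    end].

Lemma point_rel_sym (N N' : relmodel Ag At) S0 S0'
    (x : component b * point (N := N) S0 (range act) l)
    (x' : component b * point (N := N') S0' (range act) l) :
  point_rel x x' -> point_rel x' x.
Proof.
case=> x1 x'1; rewrite /point_rel.
case: (sval x.2) (sval x'.2) => [[p u0]|//] [[p' u0']|//] h.
by split=> //; apply: walk_rel_sym.
Qed.

Lemma valid_base (N : relmodel Ag At) S0 a (p : walk N) u0 :
  valid_walk S0 (range act) u0 p -> valid_walk S0 (range act) u0 (base a p).
Proof.
by rewrite /base; case: asboolP => //; case: p => // -[c u] q _ [].
Qed.

Lemma size_base (N : relmodel Ag At) a (p : walk N) : size (base a p) <= size p.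
Proof. by rewrite /base; case: asboolP; rewrite ?size_behead ?leq_pred. Qed.

(** Without gluing, the side of a point in a class tells whether it is the common walk or an
    extension of it. *)
Lemma point_class_sideN (N : relmodel Ag At) a (z : walk N * world N + world N) q u0 :
  point_class l false (Some a) z = inl (q, u0) -> point_side a z = false ->
  z = inl (q, u0) /\ ~ headed a q.
Proof.
case: z => [[p u1]|u] //=; rewrite andbF /base => + hp.
by rewrite hp => -[<- <-]; split=> //; apply/asboolPn; rewrite hp.
Qed.

Lemma point_class_side (N : relmodel Ag At) a (z : walk N * world N + world N) q u0 :
  point_class l false (Some a) z = inl (q, u0) -> point_side a z ->
  exists u, z = inl ((a, u) :: q, u0).
Proof.
case: z => [[p u1]|u] //=; rewrite andbF /base => + hp; rewrite hp => -[<- <-].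
by move/asboolP: hp; case: p => // -[c u] p /= <-; exists u.
Qed.

Section Forth.
Variables (N N' : relmodel Ag At) (Ne : epistemic N) (Ne' : epistemic N').
Variables (S0 : set (world N)) (S0' : set (world N')).
Hypotheses (S0_neq0 : S0 !=set0) (S0'_neq0 : S0' !=set0).
Let U := unravelling Ne (range act) l b S0_neq0 false.
Let U' := unravelling Ne' (range act) l b S0'_neq0 false.

(* A one-sided [t] consists of extensions, and is matched through the types of
   their common walk, or is at most that walk itself. *)
Lemma truncated_forth (x : fworld U) (x' : fworld U') a (t : set (fworld U)) :
  point_rel x x' -> fSigma a x t ->
  exists2 t', fSigma a x' t' & matched (@point_rel N N' S0 S0') t t'.
Proof.
move=> [x1 x1' xx'] [tx ts St].
have := svalP x.2; have := svalP x'.2; move: xx' tx St.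
rewrite /= x1 /=; case xE : (sval x.2) => [[p u0]|//] /=.
case xE' : (sval x'.2) => [[p' u0']|//] /= pp' tx St [vp' pl'] [vp pl].
set q := base a p in tx; pose q' := base a p'.
rewrite andbF in tx.
have qq' : walk_rel q u0 q' u0' := walk_rel_base a pp'.
have vq : valid_walk S0 (range act) u0 q := valid_base a vp.
have tc y : t y -> y.1 = None /\ point_class l false (Some a) (sval y.2) = inl (q, u0).
  by move=> /tx[y1 yc]; split=> //; move: yc; rewrite y1.
have [[y0 ty0 sy0]|sideN] := pselect (exists2 y, t y & point_side a (sval y.2)).
  have tE y : t y -> exists u, sval y.2 = inl ((a, u) :: q, u0).
    move=> ty; apply: point_class_side (tc y ty).2 _.
    by have /= -> := ts y y0 ty ty0.
  have [u1 y0E] := tE y0 ty0.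
  have [[_ [i _ ia] _ nh] ql] : valid_walk S0 (range act) u0 ((a, u1) :: q) /\ size q < l.
    by have := svalP y0.2; rewrite y0E.
  pose s1 := [set fpi y | y in t].
  have Sq : star_Sigma a (endpoint q u0) s1.
    by rewrite (accessible_star Ne (accessible_base Ne a vp)).
  (* As [size q < l], the endpoints of [q] and [q'] share their type of depth [(l - size q).+1];
     matching [s1] costs one level and leaves the depth that [walk_rel] demands of the
     extensions. *)
  have := walk_rel_colour qq'; rewrite subSn; last exact: ltnW.
  move=> /mcolourS[_ /(_ i s1)]; rewrite ia => /(_ Sq)[s1' Sq' ms].
  have vq' : valid_walk S0' (range act) u0' q' by apply: valid_base vp'.
  have accq' := accessible_base Ne' a vp'.
  have szq := walk_rel_size qq'.
  have nh' : ~ headed a q' by move=> h; apply: nh; apply/(walk_rel_headed a qq').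
  have mk u' : s1' u' -> is_point S0' (range act) l (inl ((a, u') :: q', u0')).
    move=> su'; split=> /=; last by rewrite -szq.
    split=> //; first by exists i.
    exact: star_Sigma_accessible Sq' su'.
  pose t' : set (fworld U') :=
    [set y | y.1 = None /\ exists2 u, s1' u & sval y.2 = inl ((a, u) :: q', u0')].
  have t'mk u' (su' : s1' u') : t' (None, exist _ _ (mk u' su')).
    by split=> //; exists u'.
  have imt' : [set fpi y | y in t'] = s1'.
    apply/seteqP; split=> [_ [y [_ [u su yu]] <-]|u su] /=; first by rewrite yu.
    by exists (None, exist _ _ (mk u su)).
  exists t'; first split.
  - move=> [j y] [/= -> [u su ->]] /=; rewrite x1' xE' /= andbF.
    by rewrite [X in if X && _ then _ else _]andbF {1}/base /= asboolT.
  - by move=> y y' [_ [u _ yu]] [_ [u' _ yu']] /=; rewrite yu yu'.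
  - rewrite imt' /= xE' /=.
    by rewrite -(accessible_star Ne' accq').
  split=> [y ty|y' [y1 [u' su' yE']]].
    have [u yE] := tE y ty; have [u' su' e] := ms.1 u (ex_intro2 _ _ y ty (congr1 _ yE)).
    exists (None, exist _ _ (mk u' su')) => //.
    by split=> //=; [case: (tc y ty)|rewrite yE /=; split].
  have [_ [y ty <-] e] := ms.2 u' su'; exists y => //.
  have [u yE] := tE y ty; split=> //; first by case: (tc y ty).
  by rewrite yE yE' /=; split=> //; move: e; rewrite /= yE.
have tE y : t y -> sval y.2 = inl (q, u0) /\ ~ headed a q.
  move=> ty; apply: point_class_sideN (tc y ty).2 _.
  by apply/negbTE/negP => h; apply: sideN; exists y.
have vq' : valid_walk S0' (range act) u0' q' by apply: valid_base vp'.
have pq' : is_point S0' (range act) l (inl (q', u0')).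
  by split=> //; apply: leq_trans (size_base a p') pl'.
pose t' : set (fworld U') := [set y | y = (None, exist _ _ pq') /\ t !=set0].
exists t'; first split.
- move=> _ [-> [y /tE[_ nh]]] /=; rewrite x1' xE' /= !andbF.
  rewrite {1}/base asboolF // => h; apply: nh.
  exact/(walk_rel_headed a qq').
- by move=> _ _ [-> _] [-> _].
- have accq' := accessible_base Ne' a vp'.
  rewrite /= xE' /=.
  apply: star_Sigma_down (star_Sigma1 (accessible_sym Ne' accq')) _.
  by move=> _ [y [-> _] <-].
split=> [y ty|_ [-> [y ty]]].
  exists (None, exist _ _ pq'); first by split=> //; exists y.
  by split=> //=; [case: (tc y ty)|case: (tE y ty) => ->].
by exists y => //; split=> //=; [case: (tc y ty)|case: (tE y ty) => ->].
Qed.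

End Forth.

(** Endpoints of related walks share a type of positive depth, so the listed atoms agree, and the
    others are empty. Back follows from forth by symmetry of [point_rel]. *)
Lemma wbisim_truncated (N N' : relmodel Ag At) (Ne : epistemic N)
    (Ne' : epistemic N') S0 S0' (S0_neq0 : S0 !=set0) (S0'_neq0 : S0' !=set0)
    (x : component b * point (N := N) S0 (range act) l)
    (x' : component b * point (N := N') S0' (range act) l) :
  (forall i, ~ range at_ i -> @rP _ _ N i = set0) ->
  (forall i, ~ range at_ i -> @rP _ _ N' i = set0) ->
  point_rel x x' ->
  @wbisim _ _ (fmodel (unravelling Ne (range act) l b S0_neq0 false))
    (fmodel (unravelling Ne' (range act) l b S0'_neq0 false)) x x'.
Proof.
move=> V0 V0'; apply: bisimulation_II_wins => {x x'} x x' xx'; split.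
- move=> i /=; case: (xx') => _ _.
  have := svalP x.2; have := svalP x'.2; rewrite /mkset.
  case: (sval x.2) (sval x'.2) => [[p u0]|//] [[p' u0']|//] /= _ [_ pl] pp'.
  have [[k _ <-]|ni] := pselect (range at_ i); last by rewrite V0 // V0'.
  have := walk_rel_colour pp'; rewrite subSn //.
  by move=> /mcolourS[/(_ k)].
- move=> a t /star_fmodel St.
  have [t' St' tt'] := truncated_forth (Ne' := Ne') (S0'_neq0 := S0'_neq0) xx' St.
  by exists t' => //; apply/star_fmodel.
- move=> a t' /star_fmodel St'.
  have [t St tt'] := truncated_forth (Ne' := Ne) (S0'_neq0 := S0_neq0)
    (point_rel_sym xx') St'.
  exists t; first exact/star_fmodel.
  by apply: matched_weaken (matched_flip tt') => y y' _ _; apply: point_rel_sym.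
Qed.

End TruncatedBisimulation.

Section UnravellingClass.
Variables (Ag At : Type) (N : relmodel Ag At).
Variables (S0 : set (world N)) (act : set Ag) (l b : nat).

Lemma finite_walks k : finite_set act -> finite_set [set: world N] ->
  finite_set [set p : walk N | size p <= k /\ forall x, List.In x p -> act x.1].
Proof.
move=> fa fN; elim: k => [|k IH].
  by apply: (@sub_finite_set _ _ [set [::]]) => // -[|x p] [].
apply: (@sub_finite_set _ _ ([set [::]] `|` (fun xp => xp.1 :: xp.2) @`
    ((act `*` [set: world N]) `*`
    [set p : walk N | size p <= k /\ forall x, List.In x p -> act x.1]))).
  move=> [|x p] [/= pk px]; first by left.
  right; exists (x, p) => //; split=> /=; first by split=> //; apply: px; left.
  by split=> // y py; apply: px; right.
rewrite finite_setU; split=> //; apply: finite_image; apply: finite_setX => //.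
exact: finite_setX.
Qed.

Lemma valid_walk_act u0 (p : walk N) x :
  valid_walk S0 act u0 p -> List.In x p -> act x.1.
Proof. by elim: p => //= -[a u] q IH [vq ? _ _] [<-//|]; apply: IH. Qed.

Lemma finite_unravelling : finite_set act -> finite_set [set: world N] ->
  finite_set [set: component b * point S0 act l].
Proof.
move=> fa fN; rewrite -setXTT; apply: finite_setX; first exact: finite_finset.
have sI : {in (@sval _ (is_point S0 act l)) @^-1` is_point S0 act l &,
    injective (@sval _ (is_point S0 act l))}.
  by move=> [x px] [y py] _ _ /= e; apply: eq_exist.
have : finite_set (is_point S0 act l).
  apply: (@sub_finite_set _ _ ((@inl _ _ @`
     ([set p : walk N | size p <= l /\ forall x, List.In x p -> act x.1] `*`
      [set: world N])) `|` (range (@inr (walk N * world N) (world N))))).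
    move=> [[p u]|u] /=; last by right; exists u.
    move=> [vp pl]; left; exists (p, u) => //; split=> //=; split=> // x.
    exact: valid_walk_act vp.
  rewrite finite_setU; split; apply: finite_image => //.
  by apply: finite_setX => //; apply: finite_walks.
move/(finite_preimage sI); apply: sub_finite_set => -[x px] _ //.
Qed.

(** Local fullness is built into frames; finiteness holds as walks have bounded length and use
    finitely many agents. *)
Lemma unravelling_in_class (Ne : epistemic N) (S0_neq0 : S0 !=set0) c C :
  finite_set act -> in_class C N ->
  in_class C (fmodel (unravelling Ne act l b S0_neq0 c)).
Proof.
move=> fa; set U := fmodel _.
have Ue : epistemic U by apply: fmodel_epistemic.
have Uf : locally_full U by apply: fmodel_locally_full.
have fU : finite_model N -> finite_model U.
  by case=> fN _; apply: fmodel_finite; apply: finite_unravelling.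
by case: C => //= -[] // *; split=> //; apply: fU.
Qed.

End UnravellingClass.

(** * Trimming to finitely many agents and atoms *)

Section Trim.
Variables (Ag At : Type) (act : set Ag) (ats : set At) (M : relmodel Ag At).

(** An inactive agent knows the actual world. The states themselves are kept, which preserves
    finiteness and local fullness. *)
Definition trim_E a (w : world M) (s : state M) : Prop :=
  (act a -> rE a w s) /\ (~ act a -> worlds_of s `<=` [set w]).

Lemma trim_E_neq0 a w : exists s, trim_E a w s.
Proof.
have [aa|na] := pselect (act a).
  by have [s Es] := rE_neq0 a w; exists s; split.
have [s0] := state_inh M.
have [s sE] := @state_down _ _ M s0 set0 (@sub0set _ _).
by exists s; split=> // _ v; rewrite /worlds_of -sE.
Qed.

Lemma trim_E_down a w s s' : trim_E a w s ->
  underl (@eps _ _ M) s' `<=` underl (@eps _ _ M) s -> trim_E a w s'.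
Proof.
move=> [Ea En] s's; split=> [/Ea Es|/En sw]; first exact: rE_down Es s's.
exact: subset_trans s's sw.
Qed.

Definition trim : relmodel Ag At :=
  RelModel (fun i => [set w | ats i /\ rP i w]) (world_inh M) (state_inh M)
    (@state_ext _ _ M) (@state_down _ _ M) trim_E_neq0 trim_E_down.

Lemma trim_accessible_act a (w v : world M) : act a ->
  @accessible _ _ trim a w v <-> accessible a w v.
Proof.
move=> aa; split=> -[s]; first by move=> [/(_ aa) ? _] ?; exists s.
by move=> Es sv; exists s.
Qed.

Lemma trim_accessible_inactive a : ~ act a ->
  forall w v : world trim, accessible a w v -> w = v.
Proof. by move=> na w v [s [_ /(_ na) sw] /sw]. Qed.

Hypothesis Me : epistemic M.

Lemma trim_accessible_refl a (w : world M) : @accessible _ _ trim a w w.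
Proof.
have [aa|na] := pselect (act a).
  by apply/trim_accessible_act => //; apply: accessible_refl.
(* Reflexivity in [M] supplies a state containing [w], hence a state coding [[set w]]. *)
have [s Es sw] := accessible_refl Me a w.
have [s' s'E] : exists s' : state M, [set w] = worlds_of s'.
  by apply: (@state_down _ _ M s) => _ ->.
have s'w : (worlds_of s' : set (world M)) w by rewrite -s'E.
by exists s' => //; split=> // _ v; rewrite s'E.
Qed.

Lemma trim_epistemic : epistemic trim.
Proof.
move=> a; have [aa|na] := pselect (act a).
  have [eq h] := Me a; split; first split.
  - exact: trim_accessible_refl.
  - move=> w v /(trim_accessible_act _ _ aa) ?; apply/(trim_accessible_act _ _ aa).
    exact: accessible_sym.
  - move=> w v x /(trim_accessible_act _ _ aa) wv /(trim_accessible_act _ _ aa) vx.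
    by apply/(trim_accessible_act _ _ aa); apply: accessible_trans vx.
  move=> w w' /(trim_accessible_act _ _ aa) /h e s.
  by split=> -[/(_ aa) Es _]; split=> // _; apply/e.
have e := trim_accessible_inactive na.
split; first split.
- exact: trim_accessible_refl.
- by move=> w v /e <-; apply: trim_accessible_refl.
- by move=> w v x /e ->.
by move=> w w' /e ->.
Qed.

Lemma trim_in_class C : in_class C M -> in_class C trim.
Proof.
have Te := trim_epistemic.
have Tf : locally_full M -> locally_full trim.
  move=> Mf a w t ta; apply: (Mf a w) => v /ta wv.
  have [aa|na] := pselect (act a); first exact/(trim_accessible_act _ _ aa).
  by rewrite (trim_accessible_inactive na wv); apply: accessible_refl.
by case: C => //= -[] // *; split=> //; apply: Tf.
Qed.

End Trim.

Fixpoint fo_over Ag At (act : set Ag) (ats : set At) m n (f : fo Ag At m n) : Prop :=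
  match f with
  | FE a _ _ => act a
  | FP i _ => ats i
  | FImp f g => fo_over act ats f /\ fo_over act ats g
  | FAllW f => fo_over act ats f
  | FAllS f => fo_over act ats f
  | _ => True
  end.

Lemma fo_over_mono Ag At (act act' : set Ag) (ats ats' : set At) m n
    (f : fo Ag At m n) : act `<=` act' -> ats `<=` ats' ->
  fo_over act ats f -> fo_over act' ats' f.
Proof.
move=> aa it; elim: f => {m n} [m n a x y|m n x y|m n i x|m n x y|m n x y|m n
  |m n f IHf g IHg|m n f IH|m n f IH] //=; [exact: aa|exact: it|].
by move=> [/IHf ? /IHg].
Qed.

Lemma fo_over_lists Ag At m n (f : fo Ag At m n) :
  exists (la : seq Ag) (lt : seq At),
    fo_over (fun a => List.In a la) (fun i => List.In i lt) f.
Proof.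
elim: f => {m n} [m n a x y|m n x y|m n i x|m n x y|m n x y|m n
  |m n f [la [lt fo]] g [la' [lt' go]]|//|//].
- by exists [:: a], [::]; left.
- by exists [::], [::].
- by exists [::], [:: i]; left.
- by exists [::], [::].
- by exists [::], [::].
- by exists [::], [::].
exists (la ++ la'), (lt ++ lt'); split.
  by apply: fo_over_mono fo => x ?; apply/List.in_or_app; left.
by apply: fo_over_mono go => x ?; apply/List.in_or_app; right.
Qed.

(** Agents and atoms carry no decidable equality, hence [List.In] and an enumeration that may repeat
    elements. *)
Lemma In_range (T : Type) (s : seq T) :
  exists n (e : 'I_n -> T), (fun x => List.In x s) `<=` range e.
Proof.
elim: s => [|x s [n [e se]]].
  by exists 0, (fun i : 'I_0 => False_rect T (notF (ltn_ord i))).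
exists n.+1, (fun i => if unlift ord0 i is Some j then e j else x) => y /= [<-|/se[i _ <-]].
  by exists ord0; rewrite ?unlift_none.
by exists (lift ord0 i); rewrite ?liftK.
Qed.

Lemma fo_over_finite Ag At m n (f : fo Ag At m n) :
  exists na (act : 'I_na -> Ag) nt (at_ : 'I_nt -> At),
    fo_over (range act) (range at_) f.
Proof.
have [la [lt fo]] := fo_over_lists f.
have [na [act sa]] := In_range la; have [nt [at_ st]] := In_range lt.
by exists na, act, nt, at_; apply: fo_over_mono fo.
Qed.

Lemma sat_trim Ag At (act : set Ag) (ats : set At) (M : relmodel Ag At) m n
    (f : fo Ag At m n) (u : m.-tuple (world M)) (v : n.-tuple (state M)) :
  fo_over act ats f -> @sat _ _ (trim act ats M) _ _ f u v <-> sat f u v.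
Proof.
elim: f u v => {m n} [m n a x y|m n x y|m n i x|m n x y|m n x y|m n
  |m n f IHf g IHg|m n f IH|m n f IH] u v //=.
- by move=> aa; split=> [[/(_ aa)]|Es].
- by move=> ti; split=> [[]|].
- by move=> [/IHf Hf /IHg Hg]; rewrite Hf Hg.
- by move=> /IH h; split=> hw w; apply/h/hw.
- by move=> /IH h; split=> hw w; apply/h/hw.
Qed.

Section TrimColour.
Variables (Ag At : Type) (n m : nat) (act : 'I_n -> Ag) (at_ : 'I_m -> At).

Lemma mcolour_trim k (M : relmodel Ag At) (w : world M) :
  @mcolour _ _ _ _ act at_ k (trim (range act) (range at_) M) w =
  mcolour act at_ k w.
Proof.
rewrite /mcolour.
have -> : (fun i => @star_Sigma _ _ (trim (range act) (range at_) M) (act i)) =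
    (fun i => @star_Sigma _ _ M (act i)).
  apply/funext => i; apply/funext => v; apply/seteqP; split=> _ [s Es <-].
    by exists s => //; case: Es => /= h _; apply: h; exists i.
  by exists s => //; split=> // -[]; exists i.
have -> // : (fun i => @rP _ _ (trim (range act) (range at_) M) (at_ i)) =
    (fun i => @rP _ _ M (at_ i)).
by apply/funext => i; apply/seteqP; split=> v; [case|split=> //; exists i].
Qed.

Lemma mcolour_trim_eq k (M M' : relmodel Ag At) (w : world M) (w' : world M') :
  mcolour act at_ k w = mcolour act at_ k w' ->
  @mcolour _ _ _ _ act at_ k (trim (range act) (range at_) M) w =
  @mcolour _ _ _ _ act at_ k (trim (range act) (range at_) M') w'.
Proof. by move=> e; rewrite [LHS]mcolour_trim [RHS]mcolour_trim. Qed.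

End TrimColour.

(** * Invariant first-order properties depend only on finite types *)

Section Truncation.
Variables (Ag At : Type) (C : model_class) (na nt q : nat).
Variables (act : 'I_na -> Ag) (at_ : 'I_nt -> At).
(** [l] and [b] are the least values allowed by [unravelling_good]. *)
Let l := (ef_radius q).+1.
Let b := (2 * q).+1.
Let A : set Ag := range act.
Let T : set At := range at_.

(** The roots form a good position for [q] rounds. States of the two models have different types, so
    they are compared through their sets of points. *)
Lemma fo_unravelling m n (f : fo Ag At m n) (N : relmodel Ag At)
    (Ne : epistemic N) (S0 : set (world N)) (S0_neq0 : S0 !=set0) :
  quantifier_rank f <= q ->
  forall (u : m.-tuple (component b * point S0 A l))
    (v : n.-tuple (state (fmodel (unravelling Ne A l b S0_neq0 true))))
    (v' : n.-tuple (state (fmodel (unravelling Ne A l b S0_neq0 false)))),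
  (forall i, roots (tnth u i)) ->
  (forall j, worlds_of (tnth v j) `<=` (@roots _ _ N S0 A l b : set _)) ->
  (forall j, worlds_of (tnth v j) = worlds_of (tnth v' j) :> set _) ->
  @sat _ _ (fmodel (unravelling Ne A l b S0_neq0 true)) _ _ f u v <->
  @sat _ _ (fmodel (unravelling Ne A l b S0_neq0 false)) _ _ f u v'.
Proof.
move=> fq u v v' ur vr vv'.
have ctx c c' := @unravelling_context _ _ N Ne S0 A l b S0_neq0 c c'.
have Xr : @pebbled _ _ N (unravelling Ne A l b S0_neq0 true) _ _ u v `<=`
    (@roots _ _ N S0 A l b : set _).
  by move=> x [[i <-]|[j /vr]].
have XE : @pebbled _ _ N (unravelling Ne A l b S0_neq0 true) _ _ u v =
    @pebbled _ _ N (unravelling Ne A l b S0_neq0 false) _ _ u v' :> set _.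
  by apply/seteqP; split=> x [?|[j xj]]; [left|right; exists j; rewrite -vv'
    |left|right; exists j; rewrite vv'].
have pos : @ef_position _ _ N (component b) b
    (unravelling Ne A l b S0_neq0 true) (unravelling Ne A l b S0_neq0 false)
    (fun x => x.1) (fun x => x.1) q _ _ u v u v'.
  have g := @unravelling_good _ _ N Ne S0 A l b S0_neq0 q _ (ltnSn _) (ltnSn _) Xr.
  exists (fun x x' => x = x' /\ short (ef_radius q) x); split.
  - by rewrite -XE.
  - by move=> i; have [_ [h _] _ _ _] := g; have [|x' _ [_ sx]] := h (tnth u i);
      [left; exists i|split].
  - move=> j; have [_ [h _] _ _ _] := g.
    have sx x : worlds_of (tnth v j) x -> short (ef_radius q) x.
      by move=> vx; have [|x' _ [_ sx]] := h x; [right; exists j|].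
    by rewrite -vv'; split=> x vx; exists x => //; split=> //; apply: sx.
split; first exact: ef_sat (ctx _ _) _ _ _ _ _ fq pos.
exact: ef_sat (ctx _ _) _ _ _ _ _ fq (ef_position_flip pos).
Qed.

Lemma in_class_epistemic (M : relmodel Ag At) : in_class C M -> epistemic M.
Proof. by case: C => // -[]. Qed.

Lemma finite_active : finite_set A.
Proof. by apply: finite_image; apply: finite_finset. Qed.

Section World.
Variables (f : fo Ag At 1 0) (P : wprop Ag At).
Hypotheses (fq : quantifier_rank f <= q) (fAT : fo_over A T f).
Hypothesis fP :
  forall M (w : world M), in_class C M -> (P w <-> sat f [tuple w] [tuple]).
Hypothesis Pinv : w_invariant C P.

(** Three steps inside the class: [f] does not notice trimming, [P] is invariant under passing to
    the glued unravelling, and [f] does not notice the truncation. *)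
Lemma w_truncate M (w : world M) (Te : epistemic (trim A T M))
    (w_neq0 : [set w] !=set0)
    (x : component b * point (N := trim A T M) [set w] A l) :
  in_class C M -> @root_of _ _ (trim A T M) [set w] A l b w x ->
  P w <-> @P (fmodel (unravelling Te A l b w_neq0 false)) x.
Proof.
move=> MC [x1 x2].
have TC := trim_in_class A T (in_class_epistemic MC) MC.
have UC c := unravelling_in_class l b Te w_neq0 c finite_active TC.
rewrite (fP w MC) -(@sat_trim _ _ A T M _ _ f [tuple w] [tuple] fAT).
rewrite -(@fP (trim A T M) w TC).
have : @wbisim _ _ (fmodel (unravelling Te A l b w_neq0 true)) (trim A T M) x w.
  have := @wbisim_unravelling _ _ _ Te [set w] A l b w_neq0
    (@trim_accessible_inactive _ _ A T M) x.
  by rewrite /= x1 x2; apply.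
move=> /(Pinv (UC true) TC) <-.
rewrite (@fP (fmodel (unravelling Te A l b w_neq0 true)) x (UC true)).
rewrite (@fP (fmodel (unravelling Te A l b w_neq0 false)) x (UC false)).
apply: (fo_unravelling (Ne := Te) (S0_neq0 := w_neq0) fq (u := [tuple x])
  (v := [tuple]) (v' := [tuple])) => [i|[]//|[]//].
by rewrite (ord1 i); exists w.
Qed.

Lemma w_colour_invariant M M' (w : world M) (w' : world M') :
  in_class C M -> in_class C M' ->
  mcolour act at_ l.+1 w = mcolour act at_ l.+1 w' -> (P w <-> P w').
Proof.
move=> MC M'C ww'.
have Te := trim_epistemic A T (in_class_epistemic MC).
have Te' := trim_epistemic A T (in_class_epistemic M'C).
have n0 : [set (w : world (trim A T M))] !=set0 by exists w.
have n0' : [set (w' : world (trim A T M'))] !=set0 by exists w'.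
have p : is_point (N := trim A T M) [set w] A l (inl ([::], w)) by [].
have p' : is_point (N := trim A T M') [set w'] A l (inl ([::], w')) by [].
pose x : component b * point _ A l := (None, exist _ _ p).
pose x' : component b * point _ A l := (None, exist _ _ p').
rewrite (@w_truncate _ w Te n0 x) // (@w_truncate _ w' Te' n0' x') //.
apply: Pinv.
- by apply: unravelling_in_class; [apply: finite_active|
    apply: trim_in_class => //; apply: in_class_epistemic].
- by apply: unravelling_in_class; [apply: finite_active|
    apply: trim_in_class => //; apply: in_class_epistemic].
apply: wbisim_truncated.
- by move=> i ni; apply/seteqP; split=> // v [/ni].
- by move=> i ni; apply/seteqP; split=> // v [/ni].
by split=> //; exact: mcolour_trim_eq ww'.
Qed.

End World.

Section State.
Variables (f : fo Ag At 0 1) (Q : sprop Ag At).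
Hypotheses (fq : quantifier_rank f <= q) (fAT : fo_over A T f).
Hypothesis fQ :
  forall M (s : state M), in_class C M -> (Q s <-> sat f [tuple] [tuple s]).
Hypothesis Qinv : s_invariant C Q.

(** This is the purpose of the index [None]: its class of roots need not lie in a class of any
    agent. *)
Lemma root_state (N : relmodel Ag At) (Ne : epistemic N) S0 (n0 : S0 !=set0) c :
  exists t : state (fmodel (unravelling Ne A l b n0 c)),
    worlds_of t = (@roots _ _ N S0 A l b : set _).
Proof.
apply: fmodel_state; have [u Su] := n0.
have p : is_point S0 A l (inl ([::], u)) by [].
exists None, (None, exist _ _ p) => y [u0 [y1 y2]].
by rewrite /= y1 y2.
Qed.

Lemma s_truncate M (s : state M) (Te : epistemic (trim A T M))
    (s_neq0 : (worlds_of s : set (world (trim A T M))) !=set0)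
    (t : state (fmodel (unravelling Te A l b s_neq0 false))) :
  in_class C M ->
  worlds_of t = (@roots _ _ (trim A T M) (worlds_of s) A l b : set _) ->
  Q s <-> Q t.
Proof.
move=> MC tr.
have TC := trim_in_class A T (in_class_epistemic MC) MC.
have UC c := unravelling_in_class l b Te s_neq0 c finite_active TC.
have [t' t'r] := root_state Te s_neq0 true.
rewrite (fQ s MC) -(@sat_trim _ _ A T M _ _ f [tuple] [tuple s] fAT).
rewrite -(@fQ (trim A T M) s TC).
have : @sbisim _ _ (fmodel (unravelling Te A l b s_neq0 true)) (trim A T M) t' s.
  have bis := @wbisim_unravelling _ _ _ Te (worlds_of s) A l b s_neq0
    (@trim_accessible_inactive _ _ A T M).
  split=> [x|w sw]; rewrite t'r.
    move=> [u [x1 x2]]; have su : worlds_of s u.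
      by have := svalP x.2; rewrite x2 => -[].
    by exists u => //; have := bis x; rewrite /= x1 x2; apply.
  have p : is_point (N := trim A T M) (worlds_of s) A l (inl ([::], w)) by [].
  exists (None, exist _ _ p); first by exists w.
  exact: bis.
move=> /(Qinv (UC true) TC) <-.
rewrite (fQ t' (UC true)) (fQ t (UC false)).
apply: (fo_unravelling (Ne := Te) (S0_neq0 := s_neq0) fq (u := [tuple])
  (v := [tuple t']) (v' := [tuple t])) => [[]//|j|j]; rewrite (ord1 j).
  by rewrite -t'r.
by rewrite -[LHS]/(worlds_of t') -[RHS]/(worlds_of t) t'r tr.
Qed.

Lemma s_colour_invariant M M' (s : state M) (s' : state M') :
  in_class C M -> in_class C M' ->
  image_colour (@mcolour _ _ _ _ act at_ l.+1 M) (worlds_of s) =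
  image_colour (@mcolour _ _ _ _ act at_ l.+1 M') (worlds_of s') ->
  (Q s <-> Q s').
Proof.
move=> MC M'C /image_colourP ss'.
(* Unravelling needs a root; two empty states are bisimilar outright. *)
have [n0|/forallNP s0] := pselect (exists w, worlds_of s w); last first.
  apply: Qinv => //; split=> [w /s0 //|w' /ss'.2[w /s0]] //.
have n0' : exists w', worlds_of s' w'.
  by have [w sw] := n0; have [w' ? _] := ss'.1 w sw; exists w'.
have Te := trim_epistemic A T (in_class_epistemic MC).
have Te' := trim_epistemic A T (in_class_epistemic M'C).
have [t tr] := root_state (S0 := worlds_of s) Te n0 false.
have [t' t'r] := root_state (S0 := worlds_of s') Te' n0' false.
rewrite (@s_truncate _ s Te n0 t) // (@s_truncate _ s' Te' n0' t') //.
apply: Qinv.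
- by apply: unravelling_in_class; [apply: finite_active|
    apply: trim_in_class => //; apply: in_class_epistemic].
- by apply: unravelling_in_class; [apply: finite_active|
    apply: trim_in_class => //; apply: in_class_epistemic].
have bis := @wbisim_truncated _ _ _ _ act at_ l b _ _ Te Te' _ _ n0 n0'.
have V (N : relmodel Ag At) i : ~ range at_ i -> @rP _ _ (trim A T N) i = set0.
  by move=> ni; apply/seteqP; split=> // v [/ni].
split; rewrite tr t'r => x [u [x1 x2]].
  have su : worlds_of s u by have := svalP x.2; rewrite x2 => -[].
  have [u' su' e] := ss'.1 u su.
  have p : is_point (N := trim A T M') (worlds_of s') A l (inl ([::], u')) by [].
  exists (None, exist _ _ p); first by exists u'.
  apply: bis; [exact: V|exact: V|split=> //].
  by rewrite x2; exact: mcolour_trim_eq e.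
have su : worlds_of s' u by have := svalP x.2; rewrite x2 => -[].
have [u' su' e] := ss'.2 u su.
have p : is_point (N := trim A T M) (worlds_of s) A l (inl ([::], u')) by [].
exists (None, exist _ _ p); first by exists u'.
apply: bis; [exact: V|exact: V|split=> //].
by rewrite x2; exact: mcolour_trim_eq e.
Qed.

End State.
End Truncation.

(** * A model in every class, and the equivalences *)

Section SingleWorld.
Variables (Ag At : Type).

Definition single_model : relmodel Ag At :=
  @RelModel Ag At unit (set unit) (fun _ _ _ => True) (fun w t => t w)
    (fun _ => set0) (inhabits tt) (inhabits set0) (fun s s' e => e)
    (fun s t _ => ex_intro _ t erefl) (fun _ _ => ex_intro _ set0 I)
    (fun _ _ _ _ _ _ => I).

Lemma single_model_in_class C : in_class C single_model.
Proof.
have fT : finite_set [set: unit] by apply: finite_finset.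
have acc a w w' : @accessible _ _ single_model a w w' by exists setT.
have e : epistemic single_model.
  by move=> a; split; [split=> [w|w v _|w v x _ _]; apply: acc|].
have lf : locally_full single_model by move=> a w t _; exists t.
have fm : finite_model single_model by split=> //; apply: finite_powerset.
by case: C.
Qed.

End SingleWorld.

(** The empty state of the one-world model supports every formula. *)
Lemma s_inq_nonempty Ag At C (Q : sprop Ag At) :
  s_inq_definable C Q -> nonempty_sprop C Q.
Proof.
move=> [f fQ]; pose s : state (single_model Ag At) := set0.
exists (single_model Ag At), s; split; first exact: single_model_in_class.
by apply/fQ; [exact: single_model_in_class|exact: support_set0].
Qed.

Lemma s_inq_downward Ag At C (Q : sprop Ag At) :
  s_inq_definable C Q -> downward_closed C Q.
Proof. by move=> [f fQ] M s t MC /(fQ _ _ MC) sf ts; apply/fQ/(support_down sf). Qed.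

Theorem theorem1p3 (Ag At : Type) (C : model_class) :
  (forall P : wprop Ag At,
     w_inq_definable C P <-> (w_fo_definable C P /\ w_invariant C P)) /\
  (forall Q : sprop Ag At,
     s_inq_definable C Q <->
       (s_fo_definable C Q /\ downward_closed C Q /\ nonempty_sprop C Q /\
        s_invariant C Q)).
Proof.
split=> [P|Q]; split.
- by move=> Pd; split; [apply: w_inq_fo|apply: w_inq_invariant].
- move=> [[f fP] Pinv].
  have [na [act [nt [at_ fAT]]]] := fo_over_finite f.
  apply: (w_definable_colour (act := act) (at_ := at_)) => M M' w w' MC M'C.
  (* [leqnn] sets [q] to the quantifier rank of [f], which fixes the depth of the colours. *)
  exact: (w_colour_invariant (leqnn _) fAT fP Pinv).
- move=> Qd; split; first exact: s_inq_fo.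
  split; first exact: s_inq_downward.
  by split; [apply: s_inq_nonempty|apply: s_inq_invariant].
- move=> [[f fQ] [Qd [Qn Qinv]]].
  have [na [act [nt [at_ fAT]]]] := fo_over_finite f.
  apply: (s_definable_colour (act := act) (at_ := at_)) => // M M' s s' MC M'C.
  exact: (s_colour_invariant (leqnn _) fAT fQ Qinv).
Qed.
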